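(* Let $0\le\ell\le n-1$ and let $\Sigma\subset\mathrm{Gr}(\ell,\mathbb{P}^n)$ be an irreducible subvariety of dimension at least two. The variety $\Sigma$ is strongly isotropic if and only if either there is an $(\ell+1)$-dimensional projective subspace $P\subset\mathbb{P}^n$ such that every $L\in\Sigma$ is contained in $P$, or there is an $(\ell-1)$-dimensional projective subspace $P\subset\mathbb{P}^n$ such that every $L\in\Sigma$ contains $P$.
   Context: $\mathbb{K}$ is an algebraically closed field of characteristic zero, $\mathbb{P}^n=\mathbb{P}(\mathbb{K}^{n+1})$. The empty set is regarded as a projective subspace of dimension $-1$. $\mathrm{Gr}(\ell,\mathbb{P}^n)$ is the Grassmannian of $\ell$-dimensional projective subspaces $L$, with affine cones $\hat L\subset\mathbb{K}^{n+1}$; one identifies $T_{\mathrm{Gr}(\ell,\mathbb{P}^n),L}=\mathrm{Hom}(\hat L,\mathbb{K}^{n+1}/\hat L)$. An irreducible subvariety $\Sigma\subset\mathrm{Gr}(\ell,\mathbb{P}^n)$ of dimension at least one is strongly isotropic if, for every smooth point $L\in\mathrm{Reg}(\Sigma)$, every homomorphism in the tangent space $T_{\Sigma,L}\subset\mathrm{Hom}(\hat L,\mathbb{K}^{n+1}/\hat L)$ has rank at most one. *)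

(* Defs.v *)
From mathcomp Require Import all_boot all_order all_algebra.
From mathcomp Require Export mpoly.

Set Implicit Arguments.
Unset Strict Implicit.
Unset Printing Implicit Defensive.

Import GRing.Theory.
Local Open Scope ring_scope.

(* Algebraic subsets of a finite-dimensional vector space E, seen as an
   affine space; polynomials are evaluated in the coordinates of a basis. *)
Section Affine.
Variables (K : fieldType) (E : vectType K).

Definition poly_eval (p : {mpoly K[\dim {:E}]}) (x : E) : K :=
  p.@[fun i => coord (vbasis {:E}) i x].

Definition poly_diff (p : {mpoly K[\dim {:E}]}) (x v : E) : K :=
  \sum_i poly_eval (mderiv i p) x * coord (vbasis {:E}) i v.

Definition algebraic (A : E -> Prop) : Prop :=
  exists S : {mpoly K[\dim {:E}]} -> Prop,
    forall x, A x <-> (forall p, S p -> poly_eval p x = 0).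

Definition vanishing_ideal (A : E -> Prop) (p : {mpoly K[\dim {:E}]}) : Prop :=
  forall x, A x -> poly_eval p x = 0.

Definition zariski_tangent (A : E -> Prop) (x v : E) : Prop :=
  forall p, vanishing_ideal A p -> poly_diff p x v = 0.

End Affine.

Section Graph.
Variables (K : fieldType) (V : vectType K) (U : {vspace V}).

(* Hom(U, V/U): the quotient V/U is represented by the complement U^C, which
   the projection V -> V/U maps isomorphically. *)
Definition hom_quot : vectType K := 'Hom(subvs_of U, subvs_of U^C%VS).

Definition hom_rank (f : hom_quot) : nat :=
  \dim (limg (f : 'Hom(subvs_of U, subvs_of U^C%VS))).

(* The map u |-> u + f u, whose image is the graph of f in V = U + U^C. *)
Definition graph_map (f : hom_quot) : 'Hom(subvs_of U, V) :=
  linfun vsval + (linfun vsval \o (f : 'Hom(subvs_of U, subvs_of U^C%VS)))%VF.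

Definition graph (f : hom_quot) : {vspace V} := limg (graph_map f).

Lemma graph_mapE (f : hom_quot) (u : subvs_of U) :
  graph_map f u =
  vsval u + vsval ((f : 'Hom(subvs_of U, subvs_of U^C%VS)) u).
Proof. by rewrite /graph_map; do !rewrite lfunE /=. Qed.

Lemma dim_graph (f : hom_quot) : \dim (graph f) = \dim U.
Proof.
rewrite limg_dim_eq ?dimvf //.
rewrite capfv; apply/eqP; rewrite -subv0; apply/subvP => u.
rewrite memv_ker graph_mapE addr_eq0 memv0 => /eqP Eu.
have: vsval u \in (U :&: U^C)%VS.
  by rewrite memv_cap subvsP Eu memvN subvsP.
by rewrite capv_compl memv0 => /eqP u0; apply/eqP/val_inj.
Qed.

End Graph.

Section Grassmannian.
Variables (K : fieldType) (n l : nat).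

(* Points of Gr(l, P^n), given by their affine cones in K^(n+1). *)
Definition Gr := {L : {vspace 'rV[K]_n.+1} | \dim L == l.+1}.

Definition tangentGr (L : Gr) : vectType K := hom_quot (val L).

Lemma dim_graphGr (L : Gr) (f : tangentGr L) : \dim (graph f) == l.+1.
Proof. by rewrite dim_graph (valP L). Qed.

(* The standard affine chart centred at L: a homomorphism is sent to its
   graph, so that 0 is sent to L.  The charts centred at all the points form
   the usual atlas of the Grassmannian, and the chart centred at L induces
   the identification of the tangent space at L with Hom(L, K^(n+1)/L). *)
Definition chart (L : Gr) (f : tangentGr L) : Gr :=
  Sub (graph f) (dim_graphGr f).

Definition in_chart (L : Gr) (Z : Gr -> Prop) (f : tangentGr L) : Prop :=
  Z (chart f).

Definition closedGr (Z : Gr -> Prop) : Prop :=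
  forall L : Gr, algebraic (@in_chart L Z).

Definition irreducible (Z : Gr -> Prop) : Prop :=
  (exists L, Z L) /\
  forall A B : Gr -> Prop, closedGr A -> closedGr B ->
    (forall L, Z L -> A L \/ B L) ->
    (forall L, Z L -> A L) \/ (forall L, Z L -> B L).

Definition irreducible_subvariety (Z : Gr -> Prop) : Prop :=
  closedGr Z /\ irreducible Z.

Definition proper_sub (A B : Gr -> Prop) : Prop :=
  (forall L, A L -> B L) /\ (exists L, B L /\ ~ A L).

(* Krull dimension >= d: there is a chain C 0 < C 1 < ... < C d of
   irreducible closed subsets of Z. *)
Definition dim_at_least (Z : Gr -> Prop) (d : nat) : Prop :=
  exists C : nat -> Gr -> Prop,
    [/\ forall i, (i <= d)%N -> irreducible_subvariety (C i),
        forall i, (i < d)%N -> proper_sub (C i) (C i.+1)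
      & forall L, C d L -> Z L].

Definition has_dim (Z : Gr -> Prop) (d : nat) : Prop :=
  dim_at_least Z d /\ ~ dim_at_least Z d.+1.

Definition tangent (Z : Gr -> Prop) (L : Gr) (f : tangentGr L) : Prop :=
  zariski_tangent (@in_chart L Z) 0 f.

(* For an irreducible Z the local dimension is everywhere that of Z. *)
Definition smooth_point (Z : Gr -> Prop) (L : Gr) : Prop :=
  Z L /\
  exists T : {vspace tangentGr L},
    (forall f, f \in T <-> tangent Z f) /\ has_dim Z (\dim T).

Definition strongly_isotropic (Z : Gr -> Prop) : Prop :=
  [/\ irreducible_subvariety Z,
      dim_at_least Z 1
    & forall L : Gr, smooth_point Z L ->
      forall f : tangentGr L, tangent Z f -> (hom_rank f <= 1)%N].

End Grassmannian.

(* Main.v *)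
Require Import Defs.
From HB Require Import structures.
From mathcomp Require Import all_boot all_order all_algebra all_field.
From mathcomp Require Import boolp.
From mathcomp Require Import ring.

(** In a chart, [Sigma] becomes an irreducible affine variety [Y] of matrices
    with function field [F].  At a smooth point the tangent vectors extend to
    derivations of [F] over [K], so [Sigma] is strongly isotropic iff the matrix
    [D X] has rank at most one for every derivation [D], where [X] is the generic
    point of [Y].  As [dim Y >= 2], these matrices share a column or a row, say
    [dX = u dX_0] with [u] a column over [F].  Then [du /\ dX_0 = 0], and [dX_0]
    has at least two independent entries, so [du = 0] and [u] is constant since
    [K] is algebraically closed of characteristic zero.  Integrating, any
    two points of [Y] differ by a product of the fixed column [u] and a row (or
    of a column and a fixed row), which gives the subspace [P].

    That smooth points are dense, i.e. that the Krull dimension of [Sigma] is the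
    dimension of a generic tangent space, is obtained by comparing both to the
    number of algebraically independent coordinates: derivations extend uniquely
    along algebraic extensions, and chains of irreducible subsets correspond to
    successive specialisations of the generic point. *)

Set Implicit Arguments.
Unset Strict Implicit.
Unset Printing Implicit Defensive.

Import GRing.Theory.
Import Pdiv.Idomain.
Local Open Scope ring_scope.
Local Open Scope quotient_scope.

(** * Extension of derivations *)

(** The tangent space in [smooth_point] is read at the origin of the chart centred at the point
    itself, whereas the generic point lives in one fixed chart. Smoothness and rank therefore have
    to be moved between charts. The differential of a transition map is [M |-> G M N] with [G] and
    [N] invertible, so it keeps both dimensions and ranks. Krull dimension is global too, and chains
    found in a chart are carried to the Grassmannian by closure. Minimal polynomials are replaced by
    relations with coefficients in a domain, handled by pseudo-division, so that no intermediate
    field has to be built when a derivation or a specialisation is extended. Characteristic zero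
    enters through separability and through the supply of integers that avoid the roots of a given
    polynomial. Algebraic closedness supplies roots in [K], for the Nullstellensatz and for the
    constants. The additive constants left by integration vanish because the origin of the chart
    lies on [Y]. *)

Definition is_der (A B : comNzRingType) (f : A -> B) (D : A -> B) : Prop :=
  (forall a b, D (a + b) = D a + D b) /\
  (forall a b, D (a * b) = f a * D b + f b * D a).

Section Derivations.
Variables (A B : comNzRingType) (f : {rmorphism A -> B}) (D : A -> B).
Hypothesis derD : is_der f D.

Lemma der0 : D 0 = 0.
Proof. by case: derD => DD _; apply: (addrI (D 0)); rewrite -DD !addr0. Qed.

Lemma derN a : D (- a) = - D a.
Proof.
case: derD => DD _; apply: (addrI (D a)).
by rewrite -DD !subrr der0.
Qed.

Lemma der_sum (I : Type) (r : seq I) (P : pred I) (G : I -> A) :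
  D (\sum_(i <- r | P i) G i) = \sum_(i <- r | P i) D (G i).
Proof. by case: derD => DD _; apply: (big_morph D DD der0). Qed.

Lemma der1 : D 1 = 0.
Proof.
case: derD => _ DM; have := DM 1 1.
by rewrite !mulr1 rmorph1 !mul1r => /eqP; rewrite -subr_eq0 opprD addNKr oppr_eq0 => /eqP.
Qed.

Lemma der_horner (P : {poly A}) y : (forall i, D P`_i = 0) ->
  D P.[y] = (map_poly f P^`()).[f y] * D y.
Proof.
case: derD => DD DM.
elim/poly_ind: P => [|p c IHp] P0.
  by rewrite horner0 der0 deriv0 rmorph0 horner0 mul0r.
have Dc : D c = 0 by have := P0 0; rewrite coefD coefMX coefC eqxx add0r.
have Dp i : D p`_i = 0.
  by have := P0 i.+1; rewrite coefD coefMX coefC /= addr0.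
rewrite hornerMXaddC DD Dc addr0 DM (IHp Dp).
rewrite derivD derivC addr0 derivM derivX mulr1.
rewrite rmorphD rmorphM /= map_polyX hornerD hornerMX -horner_map /=.
by rewrite mulrDl addrC mulrA [f y * _]mulrC.
Qed.

End Derivations.

(* [A] is a tower of polynomial rings over [K] mapping to [F]; since [f] is not
   injective, polynomials over [A] are compared through [map_poly f]. *)
Section Elements.
Variables (A : idomainType) (F : fieldType) (f : {rmorphism A -> F}) (x : F).

Definition eval_at : {poly A} -> F := horner_eval x \o map_poly f.
HB.instance Definition _ := GRing.RMorphism.on eval_at.

Lemma eval_atE P : eval_at P = (map_poly f P).[x]. Proof. by []. Qed.

Lemma eval_atC a : eval_at a%:P = f a.
Proof. by rewrite eval_atE map_polyC hornerC. Qed.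

Lemma eval_atX : eval_at 'X = x.
Proof. by rewrite eval_atE map_polyX hornerX. Qed.

Definition transcendental := forall P, eval_at P = 0 -> map_poly f P = 0.

(** Stands in for the minimal polynomial over the fraction field of the image of [A]: the leading
    coefficient survives [f], so the multipliers of pseudo-division are harmless, and minimality
    kills the remainders. *)
Definition min_relation (m : {poly A}) :=
  [/\ f (lead_coef m) != 0, (1 < size m)%N, eval_at m = 0 &
      forall P, eval_at P = 0 -> (size P < size m)%N -> map_poly f P = 0].

Lemma transcendental_or_algebraic :
  transcendental \/ exists m, min_relation m.
Proof.
have [|nt] := pselect transcendental; [by left | right].
pose bad n := `[< exists P, [/\ eval_at P = 0, map_poly f P <> 0 & size P = n] >].
have exbad : exists n, bad n.
  case/existsNP: nt => P /not_implyP [P0 fP].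
  by exists (size P); apply/asboolP; exists P.
case: (ex_minnP exbad) => n /asboolP [m [m0 fm sm]] min_n.
have minm P : eval_at P = 0 -> (size P < size m)%N -> map_poly f P = 0.
  move=> P0 ltPm; apply: contrapT => fP.
  have : bad (size P) by apply/asboolP; exists P.
  by move/min_n; rewrite -sm leqNgt ltPm.
have m_neq0 : m != 0 by apply/eqP => E; apply: fm; rewrite E rmorph0.
exists m; split=> //.
- apply/negP => /eqP lm0; apply: fm.
  (* If the leading coefficient died under [f], removing the leading term would give a shorter
     relation with the same image. *)
  pose m' := m - lead_coef m *: 'X^((size m).-1).
  have fm' : map_poly f m' = map_poly f m.
    by rewrite rmorphB /= map_polyZ /= lm0 scale0r subr0.
  rewrite -fm'; apply: minm; first by rewrite eval_atE fm'.
  rewrite [ltnRHS](polySpred m_neq0) ltnS.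
  apply/leq_sizeP => j; rewrite leq_eqVlt => /orP [/eqP <-|ltj].
    by rewrite coefB coefZ coefXn eqxx mulr1 subrr.
  rewrite coefB coefZ coefXn (gtn_eqF ltj) mulr0 subr0 nth_default //.
  by rewrite (polySpred m_neq0).
- rewrite ltnNge; apply/negP => /size1_polyC Em; apply: fm.
  by move: m0; rewrite Em eval_atC map_polyC /= => ->; rewrite polyC0.
Qed.

Section MinRelation.
Variables (m : {poly A}) (mm : min_relation m).

Lemma min_relation_neq0 : m != 0.
Proof. by case: mm => _; case: eqP => // ->; rewrite size_poly0. Qed.

Lemma min_relation_mod P : eval_at P = 0 -> map_poly f (P %% m) = 0.
Proof.
case: mm => lm _ m0 minm P0; apply: minm; last first.
  by rewrite ltn_modp min_relation_neq0.
have := congr1 eval_at (divp_eq P m).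
rewrite rmorphD rmorphM /= m0 mulr0 add0r => <-.
by rewrite -mul_polyC rmorphM /= P0 mulr0.
Qed.

(** Separability: the derivative is shorter than [m], so it could vanish at [x] only by vanishing
    under [f]; its top coefficient is the degree of [m] times a leading coefficient that
    survives. *)
Lemma min_relation_deriv : (forall n, n.+1%:R != 0 :> F) ->
  eval_at m^`() != 0.
Proof.
move=> char0; case: mm => lm sm m0 minm; apply/negP => /eqP dm0.
have /polyP /(_ (size m).-2) : map_poly f m^`() = 0.
  by apply: minm => //; apply: lt_size_deriv; exact: min_relation_neq0.
have Es : (size m).-2.+1 = (size m).-1 by case: (size m) sm => [|[|k]].
rewrite coef_map coef_deriv coef0 Es raddfMn /= -/(lead_coef m).
rewrite -mulr_natr -Es; apply/eqP; rewrite mulf_neq0 //.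
Qed.

End MinRelation.

Section ExtendDer.
Variables (D : A -> F) (derD : is_der f D) (kerD : forall a, f a = 0 -> D a = 0).
Variable eta : F.

Definition coef_der (P : {poly A}) : F := \sum_(i < size P) D P`_i * x ^+ i.

Lemma coef_der_wide n (P : {poly A}) : (size P <= n)%N ->
  coef_der P = \sum_(i < n) D P`_i * x ^+ i.
Proof.
move=> leP; rewrite /coef_der (big_ord_widen n (fun i => D P`_i * x ^+ i)) //.
rewrite big_mkcond; apply: eq_bigr => i _; case: ltnP => // lei.
by rewrite nth_default // (der0 derD) mul0r.
Qed.

Lemma coef_derD P Q : coef_der (P + Q) = coef_der P + coef_der Q.
Proof.
rewrite (coef_der_wide (size_polyD P Q)) (coef_der_wide (leq_maxl _ (size Q))).
rewrite (coef_der_wide (leq_maxr (size P) _)) -big_split /=.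
by apply: eq_bigr => i _; rewrite coefD derD.1 mulrDl.
Qed.

Lemma coef_der_polyC a : coef_der a%:P = D a.
Proof.
rewrite (coef_der_wide (size_polyC_leq1 a)) big_ord1 expr0 mulr1.
by rewrite coefC.
Qed.

Lemma coef_derMX P : coef_der (P * 'X) = coef_der P * x.
Proof.
rewrite (@coef_der_wide (size P).+1); last first.
  by rewrite (leq_trans (size_polyMleq _ _)) // size_polyX addn2.
rewrite big_ord_recl coefMX /= (der0 derD) mul0r add0r mulr_suml.
by apply: eq_bigr => i _; rewrite coefMX /= exprSr mulrA.
Qed.

Lemma coef_derCM a P :
  coef_der (a%:P * P) = f a * coef_der P + eval_at P * D a.
Proof.
rewrite mul_polyC (@coef_der_wide (size P)); last exact: size_scale_leq.
rewrite eval_atE (@horner_coef_wide _ (size P)); last exact: size_poly.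
rewrite mulr_sumr mulr_suml -big_split /=; apply: eq_bigr => i _.
by rewrite coefZ derD.2 coef_map /=; ring.
Qed.

Lemma coef_derM : is_der eval_at coef_der.
Proof.
split; first exact: coef_derD.
elim/poly_ind => [|p a IHp] Q.
  by rewrite mul0r rmorph0 mul0r add0r -polyC0 coef_der_polyC (der0 derD) mulr0.
rewrite mulrDl -mulrA ['X * Q]mulrC mulrA !coef_derD coef_derMX IHp.
rewrite coef_derCM coef_derMX coef_der_polyC.
rewrite rmorphD rmorphM /= eval_atC eval_atX; ring.
Qed.

Definition ext_der (P : {poly A}) : F := coef_der P + eval_at P^`() * eta.

Lemma ext_derP : is_der eval_at ext_der.
Proof.
rewrite /ext_der; split=> [P Q|P Q].
  by rewrite coef_derD derivD rmorphD /=; ring.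
by rewrite coef_derM.2 derivM rmorphD !rmorphM /=; ring.
Qed.

Lemma ext_derC a : ext_der a%:P = D a.
Proof. by rewrite /ext_der coef_der_polyC derivC rmorph0 mul0r addr0. Qed.

Lemma ext_der_map0 P : map_poly f P = 0 -> ext_der P = 0.
Proof.
move=> fP0; have Pi i : f P`_i = 0.
  by rewrite -coef_map fP0 coef0.
rewrite /ext_der /coef_der big1 => [|i _]; last by rewrite kerD ?mul0r.
rewrite eval_atE -deriv_map fP0 deriv0 horner0; ring.
Qed.

End ExtendDer.

Lemma extend_der (D : A -> F) : (forall n, n.+1%:R != 0 :> F) ->
  is_der f D -> (forall a, f a = 0 -> D a = 0) ->
  exists E : {poly A} -> F, [/\ is_der eval_at E,
    forall P, eval_at P = 0 -> E P = 0 & forall a, E a%:P = D a].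
Proof.
move=> char0 derD kerD.
case: transcendental_or_algebraic => [tr|[m mm]].
  exists (ext_der D 0); split; [exact: ext_derP | | exact: ext_derC].
  by move=> P /tr; apply: ext_der_map0.
have dm := min_relation_deriv mm char0.
(* The only value at [x] compatible with [m]: it solves [coef_der D m + m'(x) * eta = 0]. *)
pose eta := - coef_der D m / eval_at m^`().
pose E := ext_der D eta; have derE : is_der eval_at E by exact: ext_derP.
have Em : E m = 0 by rewrite /E /ext_der [_ * eta]mulrC divfK // subrr.
exists E; split => // [P P0|a]; last exact: ext_derC.
have [lm _ m0 _] := mm.
(* Pseudo-division writes a power of the leading coefficient times [P] as [q * m + r]; [E] kills
   [q * m] since [m] and [E m] both vanish, and [r] maps to zero under [f]. *)
have := congr1 E (divp_eq P m); rewrite derE.1 -mul_polyC !derE.2.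
rewrite Em m0 P0 mulr0 !mul0r !addr0 eval_atC rmorphXn /= add0r.
rewrite [E (P %% m)]ext_der_map0 //; last exact: min_relation_mod.
by move/eqP; rewrite mulf_eq0 expf_eq0 (negPf lm) andbF => /eqP.
Qed.

End Elements.

Lemma tower_der (F : fieldType) (s : seq F) : (forall n, n.+1%:R != 0 :> F) ->
  forall (A : idomainType) (f : {rmorphism A -> F}) (D : A -> F),
  is_der f D -> (forall a, f a = 0 -> D a = 0) ->
  exists (A' : idomainType) (f' : {rmorphism A' -> F})
    (j : {rmorphism A -> A'}) (D' : A' -> F),
  [/\ is_der f' D', forall a, f' a = 0 -> D' a = 0, forall a, f' (j a) = f a,
      forall a, D' (j a) = D a & forall y, y \in s -> exists a, f' a = y].
Proof.
move=> char0; elim: s => [|y s IHs] A f D derD kerD.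
  by exists A, f, idfun, D.
have [E [derE kerE EC]] := extend_der y char0 derD kerD.
have [A' [f' [j [D' [derD' kerD' fj Dj sP]]]]] :=
  IHs _ (eval_at f y) E derE kerE.
exists A', f', (j \o polyC), D'; split=> // [a|a|z] /=.
- by rewrite fj /= eval_atC.
- by rewrite Dj EC.
- rewrite inE => /orP [/eqP ->|/sP //].
  by exists (j 'X); rewrite fj /= eval_atX.
Qed.

(** The quotient rule on chosen fractions. The choice does not matter: the cross difference of two
    fractions for the same element lies in the kernel of [f], hence is killed by [D]. *)
Lemma der_frac (A : idomainType) (F : fieldType) (f : {rmorphism A -> F})
    (D : A -> F) :
  is_der f D -> (forall a, f a = 0 -> D a = 0) ->
  (forall y, exists a b, f b != 0 /\ y = f a / f b) ->
  exists E : F -> F, is_der idfun E /\ forall a, E (f a) = D a.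
Proof.
move=> derD kerD gen.
have /choice [num /choice [den ndP]] := gen.
pose E y := (D (num y) - y * D (den y)) / f (den y).
have Eq a b y : f b != 0 -> f a = y * f b -> E y = (D a - y * D b) / f b.
  move=> fb fa; have [fd yE] := ndP y.
  have {yE} fn : f (num y) = y * f (den y) by rewrite {2}yE divfK.
  have : D (num y * b - a * den y) = 0.
    by apply: kerD; rewrite rmorphB !rmorphM /= fn fa; ring.
  rewrite derD.1 (derN derD) !derD.2 fn fa => /eqP; rewrite subr_eq0 => /eqP H.
  apply/eqP; rewrite /E eqr_div //; apply/eqP.
  have -> : (D (num y) - y * D (den y)) * f b
    = (y * f (den y) * D b + f b * D (num y)) - y * f (den y) * D b
        - y * D (den y) * f b by ring.
  by rewrite H; ring.
exists E; split; last first.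
  move=> a; rewrite (@Eq a 1) ?rmorph1 ?oner_neq0 ?mulr1 //.
  by rewrite (der1 derD) mulr0 subr0 divr1.
have fK y : f (den y) != 0 /\ f (num y) = y * f (den y).
  by have [fd yE] := ndP y; split=> //; rewrite {2}yE divfK.
split=> y z; have [fy ny] := fK y; have [fz nz] := fK z.
  rewrite (@Eq (num y * den z + num z * den y) (den y * den z)).
  - rewrite !derD.1 !derD.2 rmorphM /= ny nz /E; field; exact/andP.
  - by rewrite rmorphM mulf_neq0.
  - by rewrite rmorphD !rmorphM /= ny nz; ring.
rewrite (@Eq (num y * num z) (den y * den z)).
- rewrite !derD.2 rmorphM /= ny nz /E; field; exact/andP.
- by rewrite rmorphM mulf_neq0.
- by rewrite !rmorphM /= ny nz; ring.
Qed.

(** * Points, algebraic independence and derivations *)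

Definition char0 (F : fieldType) : Prop := forall n, n.+1%:R != 0 :> F.

Lemma char0_morph (F E : fieldType) (e : {rmorphism F -> E}) :
  char0 F -> char0 E.
Proof. by move=> F0 n; rewrite -(rmorph_nat e) fmorph_eq0. Qed.

Lemma char0_natr_inj (F : fieldType) : char0 F -> injective (fun n => n%:R : F).
Proof.
move=> F0 m n; wlog lemn : m n / (m <= n)%N => [W|].
  by case/orP: (leq_total m n) => /W // H /esym /H.
move/eqP; rewrite eq_sym -subr_eq0 -natrB //.
case E: (n - m)%N => [|d]; last by rewrite (negPf (F0 d)).
by move=> _; apply/eqP; rewrite eqn_leq lemn -subn_eq0 E.
Qed.

Lemma exists_nonroot (F : fieldType) (p : {poly F}) : char0 F -> p != 0 ->
  exists n : nat, p.[n%:R] != 0.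
Proof.
move=> F0 p0; apply: contrapT => /forallNP H.
have A : all (root p) [seq i%:R | i <- iota 0 (size p)].
  by apply/allP => _ /mapP [i _ ->]; apply/negPn/negP/H.
have := max_poly_roots p0 A.
rewrite size_map size_iota ltnn (map_inj_uniq (char0_natr_inj F0)) iota_uniq.
by move/(_ isT).
Qed.

Section MpolyMorphisms.
Variables (k : nat) (K : fieldType).
Implicit Types p : {mpoly K[k]}.

Lemma mpoly_ind_ring (P : {mpoly K[k]} -> Prop) :
  (forall c, P c%:MP) -> (forall i, P 'X_i) ->
  (forall p q, P p -> P q -> P (p + q)) ->
  (forall p q, P p -> P q -> P (p * q)) -> forall p, P p.
Proof.
move=> PC PX PD PM; elim/mpolyind => [|c m p _ _ Pp].
  by rewrite -mpolyC0.
apply: (PD) => //; rewrite -mul_mpolyC; apply: (PM) => //.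
rewrite mpolyXE_id; apply: (big_ind P) => [|u v|i _].
- by rewrite -mpolyC1.
- exact: PM.
elim: (m i) => [|d IHd]; first by rewrite expr0 -mpolyC1.
by rewrite exprS; apply: PM.
Qed.

Lemma mmapXU (B : comNzRingType) (c : {rmorphism K -> B}) (z : 'I_k -> B) i :
  mmap c z 'X_i = z i.
Proof. by rewrite mmapX mmap1U. Qed.

Lemma mpoly_morph_eq (B : comNzRingType) (f g : {rmorphism {mpoly K[k]} -> B}) :
  (forall a, f a%:MP = g a%:MP) -> (forall i, f 'X_i = g 'X_i) -> f =1 g.
Proof.
move=> fgC fgX; apply: mpoly_ind_ring => // p q fp fq.
  by rewrite !rmorphD /= fp fq.
by rewrite !rmorphM /= fp fq.
Qed.

Lemma mmap_morph (B B' : comNzRingType) (g : {rmorphism B -> B'})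
    (c : {rmorphism K -> B}) (z : 'I_k -> B) p :
  g (mmap c z p) = mmap (g \o c) (g \o z) p.
Proof.
apply: (mpoly_morph_eq (f := g \o mmap c z)) => [a|i] /=.
  by rewrite !mmapC.
by rewrite !mmapXU.
Qed.

Lemma mmap_eq (B : comNzRingType) (c c' : {rmorphism K -> B})
    (z z' : 'I_k -> B) : c =1 c' -> z =1 z' -> mmap c z =1 mmap c' z'.
Proof.
move=> Ec Ez; apply: (mpoly_morph_eq (f := mmap c z)) => [a|i] /=.
  by rewrite !mmapC /= Ec.
by rewrite !mmapXU Ez.
Qed.

Lemma der_eq (B : comNzRingType) (f : {rmorphism {mpoly K[k]} -> B}) D D' :
  is_der f D -> is_der f D' -> (forall a, D a%:MP = D' a%:MP) ->
  (forall i, D 'X_i = D' 'X_i) -> D =1 D'.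
Proof.
move=> dD dD' DC DX; apply: mpoly_ind_ring => // p q Dp Dq.
  by rewrite dD.1 dD'.1 Dp Dq.
by rewrite dD.2 dD'.2 Dp Dq.
Qed.

Definition diff_at (B : comNzRingType) (c : {rmorphism K -> B})
    (z v : 'I_k -> B) p : B :=
  \sum_i mmap c z (mderiv i p) * v i.

Lemma diff_at_der (B : comNzRingType) (c : {rmorphism K -> B})
    (z v : 'I_k -> B) : is_der (mmap c z) (diff_at c z v).
Proof.
split=> p q; rewrite /diff_at.
  by rewrite -big_split; apply: eq_bigr => i _; rewrite mderivD rmorphD mulrDl.
rewrite !mulr_sumr -big_split; apply: eq_bigr => i _ /=.
by rewrite mderivM rmorphD !rmorphM /=; ring.
Qed.

Lemma diff_atC (B : comNzRingType) (c : {rmorphism K -> B})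
    (z v : 'I_k -> B) a : diff_at c z v a%:MP = 0.
Proof.
by rewrite /diff_at big1 // => i _; rewrite mderivC rmorph0 mul0r.
Qed.

Lemma diff_atX (B : comNzRingType) (c : {rmorphism K -> B})
    (z v : 'I_k -> B) i : diff_at c z v 'X_i = v i.
Proof.
rewrite /diff_at (bigD1 i) //= big1 ?addr0 => [|j ji]; last first.
  by rewrite mderivX mnm1E eq_sym (negPf ji) scale0r rmorph0 mul0r.
have -> : 'X_i^`M(i) = 1 :> {mpoly K[k]}.
  rewrite mderivX mnm1E eqxx scale1r -mpolyX0; congr 'X_[_].
  by apply/mnmP => j; rewrite mnmBE subnn mnm0E.
by rewrite rmorph1 mul1r.
Qed.

Lemma der_mmap (A B : comNzRingType) (f : {rmorphism A -> B}) (D : A -> B)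
    (c : {rmorphism K -> A}) (z : 'I_k -> A) p :
  is_der f D -> (forall a, D (c a) = 0) ->
  D (mmap c z p) = diff_at (f \o c) (f \o z) (D \o z) p.
Proof.
move=> dD Dc; have dD' := diff_at_der (f \o c) (f \o z) (D \o z).
apply: (der_eq (f := mmap (f \o c) (f \o z)) (D := D \o mmap c z)) => //.
- split=> p1 p2 /=; first by rewrite rmorphD dD.1.
  by rewrite rmorphM dD.2 /= !mmap_morph.
- by move=> a; rewrite diff_atC /= mmapC Dc.
- by move=> i; rewrite diff_atX /= mmapXU.
Qed.

End MpolyMorphisms.

Lemma mpoly0_const (K : fieldType) (p : {mpoly K[0]}) : p = (p@_0)%:MP.
Proof.
apply/mpolyP => m; rewrite mcoeffC.
have -> : m = 0%MM by apply/mnmP; case.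
by rewrite eqxx mulr1.
Qed.

Section Points.
Variables (K F : fieldType) (c : {rmorphism K -> F}).

Definition indep k (z : 'I_k -> F) :=
  forall p : {mpoly K[k]}, mmap c z p = 0 -> p = 0.

Lemma indep0 (z : 'I_0 -> F) : indep z.
Proof.
move=> p; rewrite (mpoly0_const p) mmapC => /eqP.
by rewrite fmorph_eq0 => /eqP ->; rewrite mpolyC0.
Qed.

Definition alg_over k (z : 'I_k -> F) y := exists m, min_relation (mmap c z) y m.

(** The new element takes the last index because [muni] singles out the last variable. *)
Definition adjoin k (z : 'I_k -> F) (y : F) (i : 'I_k.+1) : F :=
  if unlift ord_max i is Some j then z j else y.

Lemma muni_eval k (z : 'I_k -> F) y p :
  mmap c (adjoin z y) p = eval_at (mmap c z) y (muni p).
Proof.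
apply: (mpoly_morph_eq (f := mmap c (adjoin z y))
   (g := eval_at (mmap c z) y \o @muni k K)) => [a|i] /=.
  by rewrite muniC eval_atC /= !mmapC.
rewrite mmapXU /muni mmapX mmap1U.
case: splitP => [j|j] Ej.
  rewrite eval_atC /= mmapXU /adjoin.
  have -> : i = lift ord_max j by apply: val_inj; rewrite /= /bump leqNgt ltn_ord add0n -Ej.
  by rewrite liftK.
have -> : i = ord_max.
  by apply: val_inj; move: Ej; rewrite ord1 addn0.
by rewrite eval_atX /adjoin unlift_none.
Qed.

Lemma muni_inj k (p : {mpoly K[k.+1]}) : muni p = 0 -> p = 0.
Proof.
pose back : {poly {mpoly K[k]}} -> {mpoly K[k.+1]} :=
  horner_eval 'X_ord_max \o map_poly (@mwiden k K).
suff backK : back \o @muni k K =1 idfun.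
  by move=> p0; rewrite -[p]backK /= p0 /back /= rmorph0 /horner_eval horner0.
apply: (mpoly_morph_eq (f := (horner_eval 'X_ord_max \o
  map_poly (@mwiden k K)) \o @muni k K)) => [a|i] /=.
  by rewrite muniC map_polyC /= /horner_eval hornerC mwidenC.
rewrite /muni mmapX mmap1U.
case: splitP => [j|j] Ej.
  rewrite map_polyC /horner_eval hornerC /= mwidenX mnmwiden1; congr ('X_[U_(_)]).
  by apply: val_inj.
rewrite map_polyX /horner_eval hornerX; congr ('X_[U_(_)]).
by apply: val_inj; move: Ej; rewrite ord1 addn0.
Qed.

Lemma indep_adjoin k (z : 'I_k -> F) y :
  indep z -> transcendental (mmap c z) y -> indep (adjoin z y).
Proof.
move=> iz ty p; rewrite muni_eval => /ty H; apply: muni_inj.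
apply/polyP => i; rewrite coef0; apply: iz.
by rewrite -coef_map /= H coef0.
Qed.

Lemma indep_sub k l (z : 'I_k -> F) (h : 'I_l -> 'I_k) :
  injective h -> indep z -> indep (z \o h).
Proof.
move=> injh iz p p0.
(* Renaming variables along the injection [h] has a left inverse, which sends the variables outside
   the image of [h] to 0. *)
have E : mmap (@mpolyC l K) (fun i => if [pick j | h j == i] is Some j then 'X_j else 0)
    (mmap (@mpolyC k K) (fun j => 'X_(h j)) p) = p.
  rewrite mmap_morph.
  apply: (mpoly_morph_eq (f := mmap (_ \o @mpolyC k K) _) (g := idfun)) => [a|i] /=.
    by rewrite mmapC /= mmapC.
  rewrite mmapXU /= mmapXU; case: pickP => [j /eqP /injh -> //|/(_ i)].
  by rewrite eqxx.
rewrite -[p]E [X in mmap _ _ X]iz ?rmorph0 //.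
rewrite mmap_morph -p0; apply: mmap_eq => [a|i] /=; first by rewrite mmapC.
by rewrite mmapXU.
Qed.

Hypothesis F0 : char0 F.

Lemma alg_der k (z : 'I_k -> F) y (D : F -> F) :
  is_der idfun D -> (forall a, D (c a) = 0) -> (forall j, D (z j) = 0) ->
  alg_over z y -> D y = 0.
Proof.
move=> dD Dc Dz [m mm]; have dm := min_relation_deriv mm F0.
have [_ _ m0 _] := mm.
have : D (map_poly (mmap c z) m).[y] = 0.
  by rewrite -eval_atE m0 (der0 dD).
rewrite (der_horner dD) => [|i].
  rewrite map_poly_id // deriv_map -eval_atE /= => /eqP.
  by rewrite mulf_eq0 (negPf dm) => /eqP.
rewrite coef_map /= (der_mmap _ _ dD) // /diff_at big1 // => j _ /=.
by rewrite Dz mulr0.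
Qed.

Variables (N : nat) (x : 'I_N -> F).

Definition generated := forall y, exists p q : {mpoly K[N]},
  mmap c x q != 0 /\ y = mmap c x p / mmap c x q.

Hypothesis genF : generated.

(** By independence the polynomial ring in [z] embeds in [F], so the partial derivatives there may
    be given any values; the tower then reaches all coordinates of [x], and fractions give all of
    [F]. *)
Lemma exists_der k (z eta : 'I_k -> F) : indep z ->
  exists D : F -> F, [/\ is_der idfun D, forall a, D (c a) = 0 &
    forall j, D (z j) = eta j].
Proof.
move=> iz.
have [|A' [f' [j [D' [dD' kD' fj Dj sP]]]]] := tower_der
   (codom x) F0 (diff_at_der c z eta).
  by move=> p /= /iz ->; rewrite -mpolyC0 diff_atC.
have /choice [a aP] : forall i, exists a, f' a = x i.
  by move=> i; apply/sP/codom_f.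
have cP b : f' (j b%:MP) = c b by rewrite fj /= mmapC.
have imP p : f' (mmap (j \o @mpolyC k K) a p) = mmap c x p.
  by rewrite mmap_morph; apply: mmap_eq => b /=.
have [|D [dD DE]] := der_frac dD' kD'.
  move=> y; have [p [q [q0 ->]]] := genF y.
  exists (mmap (j \o @mpolyC k K) a p), (mmap (j \o @mpolyC k K) a q).
  by rewrite !imP.
exists D; split=> // [b|i].
  by rewrite -cP DE Dj diff_atC.
by rewrite -(mmapXU c z) -fj DE Dj diff_atX.
Qed.

Lemma der_fixed (D : F -> F) : is_der idfun D -> (forall a, D (c a) = 0) ->
  (forall i, D (x i) = 0) -> forall y, D y = 0.
Proof.
move=> dD Dc Dx y; have [p [q [q0 ->]]] := genF y.
have Dp p' : D (mmap c x p') = 0.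
  rewrite (der_mmap _ _ dD) // /diff_at big1 // => j _ /=.
  by rewrite Dx mulr0.
set u := mmap c x p; set v := mmap c x q.
have : D (u / v * v) = 0 by rewrite divfK // Dp.
by rewrite dD.2 Dp mulr0 add0r => /eqP; rewrite mulf_eq0 (negPf q0) => /eqP.
Qed.

(** A transcendence basis of the field generated by [x], chosen among the coordinates. *)
Definition basis k (h : 'I_k -> 'I_N) :=
  indep (x \o h) /\ forall i, alg_over (x \o h) (x i).

Lemma indep_coord_le n (h : 'I_n -> 'I_N) : indep (x \o h) -> (n <= N)%N.
Proof.
move=> ih; rewrite -[n]card_ord -[N]card_ord.
apply: (leq_card h) => i j Eh; apply/eqP; apply: contraT => ij.
have /(congr1 (mcoeff U_(i))) : 'X_i - 'X_j = 0 :> {mpoly K[n]}.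
  by apply: ih; rewrite rmorphB /= !mmapXU /= Eh subrr.
rewrite mcoeffB !mcoeffX eqxx mcoeff0.
rewrite eq_mnm1 [j == i]eq_sym (negPf ij) subr0 => /eqP.
by rewrite oner_eq0.
Qed.

Lemma exists_basis : exists k (h : 'I_k -> 'I_N), basis h.
Proof.
pose ok n := `[< exists h : 'I_n -> 'I_N, indep (x \o h) >].
have ok0 : exists n, ok n.
  exists 0%N; apply/asboolP; have h : 'I_0 -> 'I_N by case.
  by exists h; apply: indep0.
have okN n : ok n -> (n <= N)%N by case/asboolP => h; apply: indep_coord_le.
case: (ex_maxnP ok0 okN) => n /asboolP [h ih] maxn.
exists n, h; split=> // i.
have [tr|//] := transcendental_or_algebraic (mmap c (x \o h)) (x i).
have : ok n.+1; last by move/maxn; rewrite ltnn.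
apply/asboolP; exists (fun j => if unlift ord_max j is Some l then h l else i).
move=> p p0; apply: (indep_adjoin ih tr); rewrite -p0.
by apply: mmap_eq => // j; rewrite /adjoin /=; case: unlift.
Qed.

Lemma basis_der0 k (h : 'I_k -> 'I_N) (D : F -> F) : basis h ->
  is_der idfun D -> (forall a, D (c a) = 0) ->
  (forall j, D (x (h j)) = 0) -> forall y, D y = 0.
Proof.
move=> [ih algh] dD Dc Dx; apply: der_fixed => // i.
exact: (alg_der dD Dc Dx (algh i)).
Qed.

Lemma der_comb k (D : 'I_k -> F -> F) (w : 'I_k -> F) :
  (forall j, is_der idfun (D j)) -> is_der idfun (fun y => \sum_j w j * D j y).
Proof.
move=> dD; split=> y z.
  by rewrite -big_split; apply: eq_bigr => j _; rewrite (dD j).1 mulrDr.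
rewrite !mulr_sumr -big_split; apply: eq_bigr => j _ /=.
by rewrite (dD j).2 /=; ring.
Qed.

(** Linear algebra on derivations replaces the exchange argument: a derivation is determined by its
    values on a basis, and those on [z] can be prescribed freely. *)
Lemma indep_le_basis k l (h : 'I_k -> 'I_N) (z : 'I_l -> F) :
  basis h -> indep z -> (l <= k)%N.
Proof.
move=> bh iz; rewrite leqNgt; apply/negP => ltkl.
have /choice [D DP] : forall i : 'I_l, exists D : F -> F, [/\ is_der idfun D,
    forall a, D (c a) = 0 & forall j, D (z j) = (i == j)%:R].
  by move=> i; apply: exists_der.
(* With more derivations than basis elements, some nonzero combination [w] kills the basis, hence
   all of [F]; yet it takes the value [w 0 j] at [z j]. *)
pose M : 'M[F]_(l, k) := \matrix_(i, j) D i (x (h j)).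
have [w wM w0] : exists2 w : 'rV_l, w *m M = 0 & w != 0.
  have : kermx M != 0.
    rewrite -mxrank_eq0 mxrank_ker subn_eq0 -ltnNge.
    by rewrite (leq_ltn_trans (rank_leq_col _)).
  by case/rowV0Pn => w /sub_kermxP wM w0; exists w.
have dE := @der_comb _ D (w 0) (fun j => let: And3 dD _ _ := DP j in dD).
case/eqP: w0; apply/rowP => j; rewrite mxE.
have := basis_der0 bh dE _ _ (z j).
rewrite (bigD1 j) //= big1 => [|i ij]; last first.
  by have [_ _ ->] := DP i; rewrite (negPf ij) mulr0.
have [_ _ ->] := DP j; rewrite eqxx mulr1 addr0; apply=> [a|i].
  by rewrite big1 // => i _; have [_ -> _] := DP i; rewrite mulr0.
have /rowP /(_ i) := wM; rewrite !mxE => E; rewrite -[RHS]E.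
by apply: eq_bigr => i' _; rewrite mxE.
Qed.

(** A transcendental [y] would admit a derivation with value 1. An algebraic one has a minimal
    relation with a root in [K], and minimality forces [y] to be that root. *)
Lemma constants (y : F) : (forall p : {poly K}, (1 < size p)%N -> exists a, root p a) ->
  (forall D, is_der idfun D -> (forall a, D (c a) = 0) -> D y = 0) ->
  exists a, y = c a.
Proof.
move=> Kclosed Dy.
have [tr|[m [lm sm m0 minm]]] := transcendental_or_algebraic c y.
  (* Polynomials in no variables are identified with [K], so that the transcendence of [y] becomes
     independence of a family of length one. *)
  have iy : @indep 1 (fun=> y).
    move=> p p0; apply: muni_inj.
    have cK : cancel (fun q : {mpoly K[0]} => q@_0) (@mpolyC 0 K).
      by move=> q; rewrite -mpoly0_const.
    have h : 'I_0 -> F by case.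
    have Ep : mmap c (adjoin h y) p = 0.
      rewrite -p0; apply: mmap_eq => // i; rewrite /adjoin.
      by case: unliftP => [[]|].
    move: Ep; rewrite muni_eval => Ep.
    have H : eval_at c y (map_poly (fun q : {mpoly K[0]} => q@_0) (muni p)) = 0.
      rewrite -Ep !eval_atE -map_poly_comp_id0 ?mcoeff0 ?rmorph0 //; congr (_.[_]).
      apply: eq_map_poly => q /=; by rewrite -{2}[q]cK mmapC.
    apply/polyP => i; rewrite coef0 -[LHS]cK.
    have /polyP /(_ i) := tr _ H.
    rewrite coef_map coef0 /= coef_map_id0 ?mcoeff0 // => /eqP.
    by rewrite fmorph_eq0 => /eqP ->; rewrite mpolyC0.
  have [D [dD Dc D1]] := exists_der (fun=> 1) iy.
  by have := D1 0; rewrite Dy // => /esym /eqP; rewrite oner_eq0.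
have [a ra] := Kclosed m sm; exists a.
have /factor_theorem [q Eq] := ra.
move: (m0); rewrite Eq rmorphM /= => /eqP; rewrite mulf_eq0 => /orP [/eqP q0|].
  have q_neq0 : q != 0.
    by apply/eqP => q0'; move: sm; rewrite Eq q0' mul0r size_poly0.
  have : map_poly c q = 0.
    by apply: minm => //; rewrite Eq size_Mmonic ?monicXsubC // size_XsubC addn2.
  by move/eqP; rewrite map_poly_eq0 (negPf q_neq0).
by rewrite rmorphB /= eval_atX eval_atC subr_eq0 => /eqP.
Qed.

End Points.

(** * Specialisations *)

Section SpecStep.
Variables (A : idomainType) (F : fieldType) (f : {rmorphism A -> F}) (x : F).

Lemma trim_relation (r : {poly A}) : map_poly f r != 0 ->
  exists r', [/\ map_poly f r' = map_poly f r, f (lead_coef r') != 0 &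
    (size r' <= size r)%N].
Proof.
move=> fr0; set n := size (map_poly f r).
have nr : (n <= size r)%N by exact: size_poly.
have Er : map_poly f (\poly_(i < n) r`_i) = map_poly f r.
  apply/polyP => i; rewrite !coef_map coef_poly.
  by case: ltnP => // lei; rewrite raddf0 -coef_map nth_default.
exists (\poly_(i < n) r`_i); split=> //; last exact: leq_trans (size_poly _ _) nr.
have lastn : f r`_n.-1 != 0.
  by rewrite -coef_map -/(lead_coef (map_poly f r)) lead_coef_eq0.
rewrite lead_coef_poly //; first by rewrite /n size_poly_gt0.
by apply: contraNneq lastn => ->; rewrite raddf0.
Qed.

Variable m : {poly A}.
Hypothesis mm : min_relation f x m.

Definition cofactors (g : {poly A}) := exists u v d, f d != 0 /\
  map_poly f (u * g + v * m) = (f d)%:P.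

(** Bezout for [g] and [m], up to a constant surviving [f]: [m] behaves as an irreducible
    polynomial. Euclid's algorithm is run by pseudo-division, trimming each remainder so that its
    leading coefficient survives [f]. *)
Lemma min_relation_cofactors (g : {poly A}) : eval_at f x g != 0 -> cofactors g.
Proof.
have [lm sm m0 minm] := mm; have m_neq0 := min_relation_neq0 mm.
have fg_neq0 g1 : eval_at f x g1 != 0 -> map_poly f g1 != 0.
  by apply: contraNneq; rewrite eval_atE => ->; rewrite horner0.
have small n (g1 : {poly A}) : (size g1 <= n)%N -> (size g1 < size m)%N ->
    f (lead_coef g1) != 0 -> eval_at f x g1 != 0 -> cofactors g1.
  elim: n => [|n IHn] in g1 *.
    by rewrite leqn0 size_poly_eq0 => /eqP ->; rewrite rmorph0 eqxx.
  move=> sg1n sg1m lg1 eg1.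
  have g1_neq0 : g1 != 0 by apply: contraNneq eg1 => ->; rewrite rmorph0.
  have [sg1|sg1] := leqP (size g1) 1.
    exists 1, 0, (lead_coef g1); split=> //.
    rewrite mul1r mul0r addr0 (size1_polyC sg1) map_polyC /=.
    by rewrite lead_coefC.
  have eqd := divp_eq m g1; set q := m %/ g1 in eqd; set r := m %% g1 in eqd.
  (* Otherwise [r] would map to zero, and so would the quotient [q], which vanishes at [x] and is
     shorter than [m]; then [m] itself would map to zero. *)
  have er : eval_at f x r != 0.
    apply/negP => /eqP er; have fr0 : map_poly f r = 0.
      apply: minm => //; apply: leq_ltn_trans sg1m; apply: ltnW.
      by rewrite ltn_modp.
    have := congr1 (eval_at f x) eqd; rewrite rmorphD rmorphM /= er addr0.
    rewrite -mul_polyC rmorphM /= m0 mulr0 => /esym /eqP.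
    rewrite mulf_eq0 (negPf eg1) orbF => /eqP eq0.
    have fq0 : map_poly f q = 0.
      apply: minm => //; rewrite size_divp //.
      by rewrite ltn_subrL -subn1 subn_gt0 sg1 ltnW.
    have := congr1 (map_poly f) eqd; rewrite rmorphD rmorphM /= fr0 fq0 mul0r addr0.
    rewrite map_polyZ /= => /eqP; rewrite -size_poly_eq0 size_scale.
      by rewrite size_poly_eq0 => /eqP E; move: lm; rewrite /lead_coef -coef_map E coef0 eqxx.
    by rewrite rmorphXn expf_neq0.
  have [r' [fr' lr' sr']] := trim_relation (fg_neq0 _ er).
  have sr'g : (size r' < size g1)%N by apply: leq_ltn_trans sr' _; rewrite ltn_modp.
  have [||||u [v [d [d0 Ed]]]] := IHn r' => //.
  - by rewrite -ltnS; apply: leq_trans sg1n.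
  - exact: ltn_trans sg1m.
  - by rewrite eval_atE fr' -eval_atE.
  exists (- u * q), (u * (lead_coef g1 ^+ scalp m g1)%:P + v), d; split=> //.
  have {Ed} <- : map_poly f (u * r + v * m) = (f d)%:P.
    by rewrite -Ed !rmorphD !rmorphM /= fr'.
  congr map_poly.
  rewrite mulrDl -mulrA mul_polyC eqd; ring.
move=> eg; have eqd := divp_eq g m; set q := g %/ m in eqd; set r := g %% m in eqd.
have er : eval_at f x r != 0.
  have := congr1 (eval_at f x) eqd; rewrite rmorphD rmorphM /= m0 mulr0 add0r => <-.
  rewrite -mul_polyC rmorphM /= eval_atC mulf_neq0 // rmorphXn expf_neq0 //.
have [r' [fr' lr' sr']] := trim_relation (fg_neq0 _ er).
have [||||u [v [d [d0 Ed]]]] := @small (size r') r' => //.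
- by apply: leq_ltn_trans sr' _; rewrite ltn_modp.
- by rewrite eval_atE fr' -eval_atE.
exists (u * (lead_coef m ^+ scalp g m)%:P), (v - u * q), d; split=> //.
have {Ed} <- : map_poly f (u * r + v * m) = (f d)%:P.
  by rewrite -Ed !rmorphD !rmorphM /= fr'.
congr map_poly.
rewrite -mulrA mul_polyC eqd; ring.
Qed.

End SpecStep.

(** The element [a] collects what must not vanish. If [x] is transcendental it is a leading
    coefficient that keeps [g] nonzero. If [x] is algebraic it is the leading coefficient of the
    minimal relation times the Bezout constant, which keeps [g] nonzero at every root of the
    specialised relation. *)
Lemma spec_step (A : idomainType) (F : fieldType) (f : {rmorphism A -> F}) (x : F)
    (g : {poly A}) : eval_at f x g != 0 ->
  exists a, f a != 0 /\ forall (L : fieldType) (phi : {rmorphism A -> L}),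
    char0 L -> (forall b, f b = 0 -> phi b = 0) -> phi a != 0 ->
    exists q : {poly L}, size q != 1 /\
    forall (L' : fieldType) (e : {rmorphism L -> L'}) xi,
      root (map_poly e q) xi ->
      (forall P, eval_at f x P = 0 -> eval_at (e \o phi) xi P = 0) /\
      eval_at (e \o phi) xi g != 0.
Proof.
move=> eg; have [tr|[m mm]] := transcendental_or_algebraic f x.
  have : map_poly f g != 0.
    by apply: contraNneq eg; rewrite eval_atE => ->; rewrite horner0.
  case/trim_relation => g' [Eg' lg' _].
  exists (lead_coef g'); split=> // L phi L0 kphi pg.
  have kphiP P : map_poly f P = 0 -> map_poly phi P = 0.
    move=> P0; apply/polyP => i; rewrite coef0 coef_map /= kphi //.
    by rewrite -coef_map P0 coef0.
  have gn0 : map_poly phi g != 0.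
    have -> : map_poly phi g = map_poly phi g'.
      apply/eqP; rewrite -subr_eq0 -rmorphB /=; apply/eqP/kphiP.
      by rewrite rmorphB /= Eg' subrr.
    by apply: contraNneq pg => E; rewrite /lead_coef -coef_map E coef0.
  have [n ng] := exists_nonroot L0 gn0.
  (* A free choice of value is presented as the root of a linear polynomial, so that both cases ask
     for a root of some [q]. *)
  exists ('X - n%:R%:P); split; first by rewrite size_XsubC.
  move=> L' e xi; rewrite rmorphB /= map_polyX map_polyC /= root_XsubC => /eqP ->.
  split=> [P /tr /kphiP P0|]; first by rewrite eval_atE map_poly_comp P0 rmorph0 horner0.
  by rewrite eval_atE map_poly_comp horner_map /= fmorph_eq0.
have [lm sm m0 minm] := mm.
have [u [v [d [d0 Ed]]]] := min_relation_cofactors mm eg.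
exists (lead_coef m * d); split; first by rewrite rmorphM mulf_neq0.
move=> L phi L0 kphi; rewrite rmorphM mulf_eq0 negb_or => /andP [pm pd].
have kphiP P : map_poly f P = 0 -> map_poly phi P = 0.
  move=> P0; apply/polyP => i; rewrite coef0 coef_map /= kphi //.
  by rewrite -coef_map P0 coef0.
exists (map_poly phi m); split.
  by rewrite size_map_poly_id0 // neq_ltn sm orbT.
move=> L' e xi; rewrite -map_poly_comp /= => /rootP rxi.
have em0 : eval_at (e \o phi) xi m = 0 by [].
have ekP P : map_poly f P = 0 -> eval_at (e \o phi) xi P = 0.
  by move/kphiP => P0; rewrite eval_atE map_poly_comp P0 rmorph0 horner0.
split=> [P P0|].
  have := congr1 (eval_at (e \o phi) xi) (divp_eq P m).
  rewrite rmorphD rmorphM /= em0 mulr0 add0r (ekP (P %% m)); last exact: (min_relation_mod mm).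
  rewrite -mul_polyC rmorphM /= eval_atC => /eqP.
  by rewrite mulf_eq0 fmorph_eq0 rmorphXn expf_eq0 (negPf pm) andbF => /eqP.
have : eval_at (e \o phi) xi (u * g + v * m - d%:P) = 0.
  by apply: ekP; rewrite rmorphB /= Ed map_polyC subrr.
rewrite rmorphB rmorphD !rmorphM /= em0 mulr0 addr0 eval_atC /= => /eqP.
rewrite subr_eq0 => /eqP E; apply: contraNneq pd => g0.
by move: E; rewrite g0 mulr0 => /esym /eqP; rewrite fmorph_eq0.
Qed.

(* [good L c] restricts the target fields [c : K -> L] of specialisations. *)
Definition root_closed (K : fieldType)
    (good : forall L : fieldType, (K -> L) -> Prop) : Prop :=
  forall (L : fieldType) (c : K -> L), good L c ->
  forall q : {poly L}, size q != 1 ->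
  exists (L' : fieldType) (e : {rmorphism L -> L'}) (xi : L'),
    good L' (e \o c) /\ root (map_poly e q) xi.

(** The condition that [g] survive is pushed down the tower one level at a time, until it becomes
    the survival of a single element [a] of the base. *)
Lemma tower_spec (K F : fieldType) (s : seq F)
    (good : forall L : fieldType, (K -> L) -> Prop) :
  root_closed good ->
  forall (A : idomainType) (f : {rmorphism A -> F}),
  exists (A' : idomainType) (f' : {rmorphism A' -> F})
    (j : {rmorphism A -> A'}),
  [/\ forall a, f' (j a) = f a, forall y, y \in s -> exists a, f' a = y &
    forall g, f' g != 0 -> exists a, f a != 0 /\
      forall (L : fieldType) (c : K -> L) (phi : {rmorphism A -> L}),
      char0 L -> good L c -> (forall b, f b = 0 -> phi b = 0) -> phi a != 0 ->
      exists (L' : fieldType) (e : {rmorphism L -> L'})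
        (phi' : {rmorphism A' -> L'}),
      [/\ good L' (e \o c), forall b, phi' (j b) = e (phi b),
          forall b, f' b = 0 -> phi' b = 0 & phi' g != 0]].
Proof.
move=> gr; elim: s => [|y s IHs] A f.
  exists A, f, idfun; split=> // g fg; exists g; split=> // L c phi L0 gL kphi pg.
  by exists L, idfun, phi; split.
have [A' [f' [j [fj sP specP]]]] := IHs _ (eval_at f y).
exists A', f', (j \o polyC); split=> [a|z|g fg] /=.
- by rewrite fj /= eval_atC.
- rewrite inE => /orP [/eqP ->|/sP //].
  by exists (j 'X); rewrite fj /= eval_atX.
have [P1 [eP1 P1P]] := specP g fg.
have [a [fa aP]] := spec_step eP1.
exists a; split=> // L c phi L0 gL kphi pa.
have [q [sq qP]] := aP L phi L0 kphi pa.
have [L1 [e1 [xi [gL1 rxi]]]] := gr L c gL q sq.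
have [kphi1 phi1P1] := qP L1 e1 xi rxi.
have [L2 [e2 [phi2 [gL2 phi2j kphi2 phi2g]]]] :=
  P1P L1 (e1 \o c) (eval_at (e1 \o phi) xi) (char0_morph e1 L0) gL1 kphi1 phi1P1.
exists L2, (e2 \o e1), phi2; split=> // b /=.
by rewrite phi2j /= eval_atC.
Qed.

Lemma root_closed_all (K : fieldType) : @root_closed K (fun _ _ => True).
Proof.
move=> L c _ q sq.
have [-> |q0] := eqVneq q 0.
  by exists L, idfun, 0; split=> //; rewrite rmorph0 root0.
have [p [irr_p pq]] : exists p : {poly L}, irreducible_poly p /\ p %| q.
  have {q0 sq} : (1 < size q)%N by rewrite ltn_neqAle eq_sym sq size_poly_gt0.
  have [n] := ubnP (size q); elim: n q => // n IHn q ltqn q1.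
  have [irr|/not_andP [//|]] := pselect (irreducible_poly q).
    by exists q; split=> //; exact: dvdpp.
  case/existsNP => d /not_implyP [sd /not_implyP [dq ndq]].
  have d0 : d != 0 by apply: contraTneq dq => ->; rewrite dvd0p -size_poly_gt0 ltnW.
  have [||p [irr_p pd]] := IHn d.
  - rewrite -ltnS; apply: leq_trans (ltqn).
    rewrite ltnS ltn_neqAle dvdp_leq ?andbT //; last first.
      by rewrite -size_poly_gt0 ltnW.
    by apply: contra_not_neq ndq => /eqP E; rewrite -dvdp_size_eqp.
  - by rewrite ltn_neqAle eq_sym sd size_poly_gt0.
  by exists p; split=> //; apply: dvdp_trans dq.
have [L' _ [z rz _]] := irredp_FAdjoin irr_p.
exists L', (in_alg L'), z; split=> //.
by apply: root_dvdp rz; rewrite dvdp_map.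
Qed.

(** The retraction sends [q] to a polynomial over [K], which has a root there; with these targets a
    specialisation yields a point with coordinates in [K]. *)
Lemma root_closed_retract (K : closedFieldType) :
  @root_closed K (fun L c => exists r : {rmorphism L -> K}, forall a, r (c a) = a).
Proof.
move=> L c [r rc] q sq.
have /closed_rootP [a ra] : size (map_poly r q) != 1 by rewrite size_map_poly.
by exists K, r, a; split=> //; exists idfun.
Qed.

Lemma tower_image (K F : fieldType) N (A' : idomainType) (f' : {rmorphism A' -> F})
    (i : {rmorphism K -> A'}) (x : 'I_N -> F) (c : {rmorphism K -> F}) :
  (forall a, f' (i a) = c a) -> (forall y, y \in codom x -> exists a, f' a = y) ->
  exists b : 'I_N -> A', (forall l, f' (b l) = x l) /\
    forall p, f' (mmap i b p) = mmap c x p.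
Proof.
move=> fi sP; have /choice [b bP] : forall l, exists a, f' a = x l.
  by move=> l; apply/sP/codom_f.
by exists b; split=> // p; rewrite mmap_morph; apply: mmap_eq.
Qed.

(* The Nullstellensatz for the prime ideal of relations of [x]. *)
Lemma closed_specialisation (K : closedFieldType) (F : fieldType)
    (c : {rmorphism K -> F}) N (x : 'I_N -> F) (g : {mpoly K[N]}) :
  char0 K -> mmap c x g != 0 ->
  exists xi : 'I_N -> K, (forall p, mmap c x p = 0 -> p.@[xi] = 0) /\
    g.@[xi] != 0.
Proof.
move=> K0 xg.
have [A [f [j [fj sP specP]]]] := tower_spec (codom x) (@root_closed_retract K) c.
have [b [fb imP]] := tower_image fj sP.
have [|a [ca aP]] := specP (mmap j b g); first by rewrite imP.
have [||| L [e [phi [[r re] phij kphi phig]]]] := aP K idfun idfun K0.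
- by exists idfun.
- by move=> d /eqP; rewrite fmorph_eq0 => /eqP.
- by apply: contraNneq ca => /= ->; rewrite rmorph0.
have E p : r (phi (mmap j b p)) = p.@[r \o phi \o b].
  rewrite -[RHS]/(mmap _ _ p) !mmap_morph; apply: mmap_eq => // d /=.
  by rewrite phij re.
exists (r \o phi \o b); split=> [p p0|]; last by rewrite -E fmorph_eq0.
by rewrite -E kphi ?rmorph0 // imP.
Qed.

(** The last of the independent coordinates is specialised to an integer [n]. This adds the relation
    ['X_i0 - n], and the other [k] coordinates remain independent. *)
Lemma proper_specialisation (K F : fieldType) (c : {rmorphism K -> F}) N k
    (x : 'I_N -> F) (h : 'I_k.+1 -> 'I_N) :
  char0 K -> indep c (x \o h) ->
  exists (L : fieldType) (d : {rmorphism K -> L}) (y : 'I_N -> L)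
    (h' : 'I_k -> 'I_N),
  [/\ forall p, mmap c x p = 0 -> mmap d y p = 0,
      exists p, mmap d y p = 0 /\ mmap c x p != 0 & indep d (y \o h')].
Proof.
move=> K0 ih.
have [A [f [j [fj sP specP]]]] :=
  tower_spec (codom x) (@root_closed_all K) (mmap c (x \o h)).
have fjC a : f ((j \o @mpolyC k.+1 K) a) = c a by rewrite /= fj /= mmapC.
have [b [fb imP]] := tower_image fjC sP.
have [|a [ca aP]] := specP 1; first by rewrite rmorph1 oner_neq0.
pose i0 := h ord_max; pose h' := h \o lift ord_max.
pose z := x \o h'.
have F0 : char0 F := char0_morph c K0.
have Ez : mmap c (x \o h) =1 mmap c (adjoin z (x i0)).
  by apply: mmap_eq => // l; rewrite /adjoin /=; case: unliftP => [l'|] -> /=.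
(* Seen as a polynomial in its last variable with coefficients in [F], [a] is nonzero, so some
   integer is not a root of it. *)
have [n nP] : exists n : nat, mmap c (adjoin z n%:R) a != 0.
  have [|n nP] := @exists_nonroot _ (map_poly (mmap c z) (muni a)) F0.
    apply: contraNneq ca => E /=.
    by rewrite Ez muni_eval eval_atE E horner0.
  by exists n; rewrite muni_eval.
have [|L [e [phi [_ phij kphi _]]]] := aP F c (mmap c (adjoin z n%:R)) F0 I _ nP.
  by move=> q /= /ih ->; rewrite rmorph0.
have phijC q : (phi \o (j \o @mpolyC k.+1 K)) q = (e \o c) q.
  by rewrite /= phij /= mmapC.
have phib l : phi (b (h l)) = e (adjoin z n%:R l).
  have E0 : f (b (h l) - j 'X_l) = 0.
    by rewrite rmorphB /= fb fj /= mmapXU subrr.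
  have /eqP := kphi _ E0; rewrite rmorphB subr_eq0 => /eqP -> /=.
  by rewrite phij /= mmapXU.
have E p : phi (mmap (j \o @mpolyC k.+1 K) b p) = mmap (e \o c) (phi \o b) p.
  by rewrite mmap_morph; apply: mmap_eq.
exists L, (e \o c), (phi \o b), h'; split=> [p p0||].
- by rewrite -E kphi // imP.
- exists ('X_i0 - n%:R%:MP); split.
    rewrite rmorphB /= mmapXU mmapC /= phib /adjoin unlift_none.
    by rewrite !rmorph_nat subrr.
  rewrite rmorphB /= mmapXU mmapC /= rmorph_nat subr_eq0.
  apply/negP => /eqP E1.
  have /(congr1 (mcoeff U_(ord_max))) : 'X_ord_max - n%:R%:MP = 0 :> {mpoly K[k.+1]}.
    by apply: ih; rewrite rmorphB /= mmapXU mmapC /= rmorph_nat /= E1 subrr.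
  rewrite mcoeffB mcoeffX mcoeffC mcoeff0 eqxx mnm1_eq0 mulr0 subr0 => /eqP.
  by rewrite oner_eq0.
- have -> : (phi \o b) \o h' = e \o z.
    apply: funext => l /=; rewrite phib /adjoin liftK //.
  have iz : indep c z by apply: (indep_sub (h := lift ord_max)) ih; exact: lift_inj.
  move=> p; rewrite -mmap_morph => /eqP; rewrite fmorph_eq0 => /eqP.
  exact: iz.
Qed.

Lemma mmap_subvars (K B : fieldType) (c : {rmorphism K -> B}) N k (x : 'I_N -> B)
    (h : 'I_k -> 'I_N) (p : {mpoly K[k]}) :
  mmap c x (mmap (@mpolyC N K) (fun i => 'X_(h i)) p) = mmap c (x \o h) p.
Proof.
by rewrite mmap_morph; apply: mmap_eq => [a|i] /=; rewrite ?mmapC ?mmapXU.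
Qed.

Lemma indep_specialisation (K F L : fieldType) (c : {rmorphism K -> F})
    (d : {rmorphism K -> L}) N k (x : 'I_N -> F) (y : 'I_N -> L)
    (h : 'I_k -> 'I_N) :
  (forall p, mmap c x p = 0 -> mmap d y p = 0) ->
  indep d (y \o h) -> indep c (x \o h).
Proof.
by move=> xy ih p p0; apply: ih; rewrite -mmap_subvars xy // mmap_subvars.
Qed.

(* A nontrivial relation between [x_(h 0), .., x_(h (k-1))] and [g] over [K]
   would specialise to a nontrivial relation between [y_(h 0), .., y_(h (k-1))],
   namely its constant coefficient in [g]. *)
Lemma indep_generalisation (K F L : fieldType) (c : {rmorphism K -> F})
    (d : {rmorphism K -> L}) N k (x : 'I_N -> F) (y : 'I_N -> L)
    (h : 'I_k -> 'I_N) (g : {mpoly K[N]}) :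
  (forall p, mmap c x p = 0 -> mmap d y p = 0) ->
  mmap d y g = 0 -> mmap c x g != 0 -> indep d (y \o h) ->
  indep c (adjoin (x \o h) (mmap c x g)).
Proof.
move=> xy yg xg ih.
pose sub : {mpoly K[k]} -> {mpoly K[N]} := mmap (@mpolyC N K) (fun i => 'X_(h i)).
have Ec p : mmap c x (sub p) = mmap c (x \o h) p by apply: mmap_subvars.
have Ed p : mmap d y (sub p) = mmap d (y \o h) p by apply: mmap_subvars.
have ix := indep_specialisation xy ih.
apply: indep_adjoin => //.
have [//|[m mm]] := transcendental_or_algebraic (mmap c (x \o h)) (mmap c x g).
have [lm sm m0 minm] := mm; exfalso.
have m00 : root m 0.
  apply/rootP/ih; rewrite -Ed horner_coef0.
  have : mmap c x (map_poly sub m).[g] = 0.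
    by rewrite -horner_map -map_poly_comp (eq_map_poly Ec).
  move/xy; rewrite -horner_map /= yg horner_coef0 coef_map /=.
  by rewrite coef_map.
(* The constant coefficient vanishes, so [m] is [q * 'X]; as the value of [g] is nonzero, [q] is a
   shorter relation. *)
have /factor_theorem [q] := m00; rewrite subr0 => Em.
have q_neq0 : q != 0.
  by apply/eqP => q0; move: sm; rewrite Em q0 mul0r size_poly0.
have fq0 : map_poly (mmap c (x \o h)) q = 0.
  apply: minm; last by rewrite Em size_mulX.
  move: m0; rewrite Em rmorphM /= eval_atX => /eqP.
  by rewrite mulf_eq0 (negPf xg) orbF => /eqP.
by move: lm; rewrite /lead_coef -coef_map /= Em rmorphM /= fq0 mul0r coef0 eqxx.
Qed.

(** * Integration of pencils of rank-one differentials *)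

Section Integration.
Variables (K F : fieldType) (c : {rmorphism K -> F}).

Definition der_over (D : F -> F) := is_der idfun D /\ forall a, D (c a) = 0.

Lemma der_over_add D D' : der_over D -> der_over D' ->
  der_over (fun y => D y + D' y).
Proof.
move=> [dD Dc] [dD' D'c]; split=> [|a]; last by rewrite Dc D'c addr0.
split=> y z; first by rewrite dD.1 dD'.1; ring.
by rewrite dD.2 dD'.2 /=; ring.
Qed.

Lemma der_over_scale r D : der_over D -> der_over (fun y => r * D y).
Proof.
move=> [dD Dc]; split=> [|a]; last by rewrite Dc mulr0.
split=> y z; first by rewrite dD.1; ring.
by rewrite dD.2 /=; ring.
Qed.

Lemma der_over_bracket D D' : der_over D -> der_over D' ->
  der_over (fun y => D (D' y) - D' (D y)).
Proof.
move=> [dD Dc] [dD' D'c]; split=> [|a].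
  split=> y z; first by rewrite dD.1 dD'.1 dD.1 dD'.1; ring.
  by rewrite dD.2 dD'.2 dD.1 dD'.1 /= !dD.2 !dD'.2 /=; ring.
by rewrite Dc D'c (der0 dD) (der0 dD') subrr.
Qed.

Hypothesis const : forall y, (forall D, der_over D -> D y = 0) ->
  exists a, y = c a.

Definition rank1_ders a b (X : 'I_a -> 'I_b -> F) :=
  forall D, der_over D -> forall p q p' q',
    D (X p q) * D (X p' q') = D (X p q') * D (X p' q).

(** Polarisation: the two by two minors are quadratic in [D], and [D + D'] is again a derivation
    over [K]. *)
Lemma rank1_ders_polar a b (X : 'I_a -> 'I_b -> F) D D' p q p' q' :
  rank1_ders X -> der_over D -> der_over D' ->
  D (X p q) * D' (X p' q') + D' (X p q) * D (X p' q') =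
  D (X p q') * D' (X p' q) + D' (X p q') * D (X p' q).
Proof.
move=> r1 dD dD'; have H := r1 _ (der_over_add dD dD') p q p' q'.
apply/eqP; rewrite -subr_eq0; apply/eqP.
transitivity ((D (X p q) + D' (X p q)) * (D (X p' q') + D' (X p' q'))
  - (D (X p q') + D' (X p q')) * (D (X p' q) + D' (X p' q))
  - (D (X p q) * D (X p' q') - D (X p q') * D (X p' q))
  - (D' (X p q) * D' (X p' q') - D' (X p q') * D' (X p' q))); first ring.
by rewrite H (r1 _ dD p q p') (r1 _ dD' p q p') !subrr.
Qed.

Definition row_pencil a b (X : 'I_a -> 'I_b -> F) :=
  exists (p0 : 'I_a) (u : 'I_a -> K) (d : 'I_a -> 'I_b -> K),
    u p0 = 1 /\ forall p q, X p q = c (u p) * X p0 q + c (d p q).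

(** The matrices of [D1] and [D2] have independent rows at [p0]. As sums of derivations still give
    rank at most one, their column spaces must agree, and [u] is the common column normalised at
    [p0]. *)
Lemma integrate_row a b (X : 'I_a -> 'I_b -> F) D1 D2 p0 q0 q1 :
  rank1_ders X -> der_over D1 -> der_over D2 ->
  D1 (X p0 q0) != 0 -> D2 (X p0 q0) = 0 -> D2 (X p0 q1) != 0 ->
  row_pencil X.
Proof.
move=> r1 d1 d2 n1 z2 n2; pose u p := D1 (X p q0) / D1 (X p0 q0).
have z2' p : D2 (X p q0) = 0.
  have := r1 _ d2 p q1 p0 q0; rewrite z2 mulr0 => /esym /eqP.
  by rewrite mulf_eq0 (negPf n2) orbF => /eqP.
have pencil0 D p q : der_over D -> D (X p0 q0) = 0 ->
    D (X p q) = u p * D (X p0 q).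
  move=> dD zD; have zD' : D (X p q0) = 0.
    have := rank1_ders_polar p q1 p0 q0 r1 dD d2.
    rewrite zD z2 !mulr0 addr0 z2' mul0r addr0 => /esym /eqP.
    by rewrite mulf_eq0 (negPf n2) orbF => /eqP.
  have := rank1_ders_polar p q p0 q0 r1 d1 dD.
  rewrite zD zD' mulr0 mul0r add0r addr0 => /(canRL (mulfK n1)) ->.
  by rewrite /u mulrAC.
(* Subtracting the multiple of [D1] that agrees with [D] at [X p0 q0] reduces to [pencil0]. *)
have pencil D p q : der_over D -> D (X p q) = u p * D (X p0 q).
  move=> dD; pose r := - (D (X p0 q0) / D1 (X p0 q0)).
  have := @pencil0 _ p q (der_over_add dD (der_over_scale r d1)).
  rewrite /r mulNr divfK // subrr => /(_ erefl).
  have -> : D1 (X p q) = u p * D1 (X p0 q).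
    have := r1 _ d1 p q p0 q0 => /(canRL (mulfK n1)) ->.
    by rewrite /u mulrAC.
  move/eqP; rewrite mulrDr mulrCA => /eqP /addIr //.
have u0 D p : der_over D -> D (u p) = 0.
  move=> dD; apply/eqP; apply: contraT => Du.
  (* This is [du /\ dX_0 = 0], obtained by applying the pencil identity to the bracket of [D] and
     [D']. *)
  have swap D' q : der_over D' -> D (u p) * D' (X p0 q) = D' (u p) * D (X p0 q).
    move=> dD'; have := pencil _ p q (der_over_bracket dD dD').
    rewrite (pencil D p q dD) (pencil D' p q dD') dD.1.2 dD'.1.2 /= => E.
    apply/eqP; rewrite -subr_eq0; apply/eqP.
    move/(congr1 (fun y => y - u p * (D (D' (X p0 q)) - D' (D (X p0 q))))): E.
    by rewrite subrr => <-; ring.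
  have D2u : D2 (u p) = 0.
    have /eqP := swap _ q0 d2; rewrite z2 mulr0 eq_sym mulf_eq0 => /orP [/eqP //|].
    move=> DX0; have := swap _ q0 d1; rewrite (eqP DX0) mulr0 => /eqP.
    by rewrite mulf_eq0 (negPf Du) (negPf n1).
  have := swap _ q1 d2; rewrite D2u mul0r => /eqP.
  by rewrite mulf_eq0 (negPf Du) (negPf n2).
have /choice [w wP] : forall p, exists e, u p = c e.
  by move=> p; apply: const => D dD; apply: u0.
have /choice [d dP] : forall pq, exists e,
    X pq.1 pq.2 - u pq.1 * X p0 pq.2 = c e.
  move=> [p q] /=; apply: const => D dD.
  rewrite dD.1.1 (derN dD.1) dD.1.2 (u0 _ _ dD) /= mulr0 addr0.
  by rewrite (pencil D p q dD) subrr.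
exists p0, w, (fun p q => d (p, q)); split=> [|p q].
  apply: (fmorph_inj c); rewrite -wP rmorph1 /u divff //.
by rewrite -dP -wP /= addrC subrK.
Qed.

(* If the common factor of the rank-one matrices [D X] is the column [u], then
   [dX = u dX_0] gives [du /\ dX_0 = 0], so that [u] is constant as soon as [dX_0]
   has two independent entries. *)
Lemma integrate_rank1 a b (X : 'I_a -> 'I_b -> F) D1 D2 :
  rank1_ders X -> der_over D1 -> der_over D2 ->
  (forall r s, (forall p q, r * D1 (X p q) = s * D2 (X p q)) -> r = 0 /\ s = 0) ->
  row_pencil X \/ row_pencil (fun q p => X p q).
Proof.
move=> r1 d1 d2 ind.
have [p0 [q0 n1]] : exists p q, D1 (X p q) != 0.
  apply: contrapT => H; have [|/eqP] := ind 1 0; last by rewrite oner_eq0.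
    move=> p q; rewrite mul0r mul1r; apply/eqP; apply: contraT => n.
    by case: H; exists p, q.
pose r := - (D2 (X p0 q0) / D1 (X p0 q0)).
have d3 := der_over_add d2 (der_over_scale r d1).
set D3 := (fun y => _) in d3.
have z3 : D3 (X p0 q0) = 0 by rewrite /D3 /r mulNr divfK // subrr.
have [p [q n3]] : exists p q, D3 (X p q) != 0.
  apply: contrapT => H; have [|_ /eqP] := ind (- r) 1; last by rewrite oner_eq0.
  move=> p q; apply/eqP; rewrite mul1r mulNr eq_sym -subr_eq0 opprK.
  by apply: contraT => n; case: H; exists p, q.
(* Since [D3] vanishes at [X p0 q0], the polarised minor shows that it is nonzero in row [p0] or in
   column [q0]; this decides between a common column and a common row. *)
have := rank1_ders_polar p q p0 q0 r1 d1 d3.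
rewrite z3 mulr0 add0r => E.
have [z|n] := eqVneq (D3 (X p0 q)) 0.
  right; apply: (@integrate_row _ _ (fun q p => X p q) D1 D3 q0 p0 p) => //.
    by move=> D dD i j i' j'; rewrite (r1 _ dD) mulrC.
  apply: contraNneq n3 => z'; move: E; rewrite z z' mulr0 mul0r addr0 => /eqP.
  by rewrite mulf_eq0 (negPf n1) orbF.
by left; apply: (@integrate_row _ _ X D1 D3 p0 q0 q).
Qed.

End Integration.

(** * Function fields of prime ideals *)

Lemma fraction_gen (R : idomainType) (y : {fraction R}) :
  exists p q, FracField.tofrac q != 0 /\ y = FracField.tofrac p / FracField.tofrac q.
Proof.
elim/quotW: y => x; exists (frac x).1, (frac x).2.
have q0 : FracField.tofrac (frac x).2 != 0 by rewrite tofrac_eq0 denom_ratioP.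
split=> //; apply: (canRL (mulfK q0)).
unlock FracField.tofrac; rewrite -[LHS]FracField.pi_mul.
apply/eqmodP => /=; rewrite FracField.equivfE /FracField.mulf.
by rewrite !numden_Ratio ?mulf_neq0 ?oner_neq0 ?denom_ratioP // !mulr1 mulrC.
Qed.

(** Fractions are taken of an integral domain structure, which carries an inverse operation; here it
    is chosen classically and is the identity off the units. *)
Lemma domain_fraction (B : comNzRingType) :
  (forall x y : B, x * y = 0 -> (x == 0) || (y == 0)) ->
  exists (F : fieldType) (phi : {rmorphism B -> F}), injective phi /\
    forall y, exists p q, phi q != 0 /\ y = phi p / phi q.
Proof.
move=> Bint; pose u : pred B := fun x => `[< exists y, y * x = 1 >].
have /choice [inv invP] : forall x : B, exists y, if u x then y * x = 1 else y = x.
  move=> x; have [/asboolP [y yx]|_] := boolP (u x); [by exists y | by exists x].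
have invV : {in u, left_inverse 1 inv *%R}.
  by move=> x ux; have := invP x; case: ifP => // /negP; case; exact: ux.
have invU x y : y * x = 1 -> u x by move=> yx; apply/asboolP; exists y.
have invN : {in [predC u], inv =1 id}.
  move=> x ux; have := invP x; case: ifP => // H _.
  by case/negP: (ux : ~~ u x).
pose mU := GRing.ComNzRing_hasMulInverse.Build B invV invU invN.
pose BU : comUnitRingType := HB.pack B mU.
pose mI := GRing.ComUnitRing_isIntegral.Build BU Bint.
pose BI : idomainType := HB.pack BU mI.
pose phi : {rmorphism BI -> {fraction BI}} := @FracField.tofrac BI.
exists {fraction BI}, phi; split.
  by move=> x y /eqP; rewrite tofrac_eq => /eqP.
exact: fraction_gen.
Qed.

Lemma prime_quotient (R : comNzRingType) (I : R -> Prop) :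
  I 0 -> ~ I 1 -> (forall a u v, I u -> I v -> I (a * u + v)) ->
  (forall u v, I (u * v) -> I u \/ I v) ->
  exists (F : fieldType) (phi : {rmorphism R -> F}),
    (forall p, phi p = 0 <-> I p) /\
    forall y, exists p q, phi q != 0 /\ y = phi p / phi q.
Proof.
move=> I0 I1 IM Iprime.
pose S : {pred R} := fun p => `[< I p >].
have SE p : (p \in S) = `[< I p >] by [].
have idS : idealr_closed S.
  split; rewrite ?SE; [exact/asboolP | exact/asboolPn |].
  by move=> a u v /asboolP Iu /asboolP Iv; apply/asboolP/IM.
have prS : prime_idealr_closed S.
  by move=> u v /asboolP /Iprime [?|?]; apply/orP; [left|right]; apply/asboolP.
pose Z := GRing.isZmodClosed.Build R S (idealr_closedB idS).
pose P := isProperIdeal.Build R S (idealr_closed_nontrivial idS).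
pose Q := isPrimeIdealrClosed.Build R S prS.
pose pI : prime_idealr R := HB.pack S Z P Q.
pose B := {ideal_quot pI}.
have Bint : forall x y : B, x * y = 0 -> (x == 0) || (y == 0).
  exact: Quotient.rquot_IdomainAxiom.
have [F [psi [psi_inj gen]]] := domain_fraction Bint.
have pi0 : \pi_B (0 : R) = 0 by exact: raddf0.
exists F, (psi \o \pi_B); split=> [p|y] /=.
  rewrite -{1}(rmorph0 psi); split=> [/psi_inj|Ip].
    move/eqP; rewrite -pi0 -Quotient.idealrBE subr0.
    by move/asboolP.
  suff -> : \pi_B p = 0 by [].
  apply/eqP; rewrite -pi0 -Quotient.idealrBE subr0.
  exact/asboolP.
have [p [q [q0 ->]]] := gen y; exists (repr p), (repr q).
by rewrite !reprK.
Qed.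

Lemma prime_point (K : fieldType) N (I : {mpoly K[N]} -> Prop) :
  I 0 -> ~ I 1 -> (forall a u v, I u -> I v -> I (a * u + v)) ->
  (forall u v, I (u * v) -> I u \/ I v) ->
  exists (F : fieldType) (c : {rmorphism K -> F}) (x : 'I_N -> F),
    (forall p, mmap c x p = 0 <-> I p) /\ generated c x.
Proof.
move=> I0 I1 IM Ip; have [F [phi [kphi gen]]] := prime_quotient I0 I1 IM Ip.
pose c : {rmorphism K -> F} := phi \o @mpolyC N K.
pose x i := phi 'X_i.
have E p : mmap c x p = phi p.
  by apply: (mpoly_morph_eq (f := mmap c x)) => [a|i] /=; rewrite ?mmapC ?mmapXU.
exists F, c, x; split=> [p|y]; first by rewrite E.
by have [p [q [q0 ->]]] := gen y; exists p, q; rewrite !E.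
Qed.

(** * Affine varieties and their generic points *)

Lemma vspace_of_closed (K : fieldType) (V : vectType K) (P : V -> Prop) :
  P 0 -> (forall a u v, P u -> P v -> P (a *: u + v)) ->
  exists T : {vspace V}, forall v, v \in T <-> P v.
Proof.
move=> P0 PL.
pose ok d := `[< exists T : {vspace V}, \dim T = d /\ forall v, v \in T -> P v >].
have ok0 : exists d, ok d.
  exists 0%N; apply/asboolP; exists 0%VS; split; first by rewrite dimv0.
  by move=> v; rewrite memv0 => /eqP ->.
have okM d : ok d -> (d <= \dim {:V})%N.
  by case/asboolP => T [<- _]; apply: dimvS; apply: subvf.
case: (ex_maxnP ok0 okM) => d /asboolP [T [dT TP]] maxd.
exists T => v; split=> [/TP //|Pv]; apply: contraT => vT.
have := maxd (\dim (T + <[v]>)); rewrite leqNgt -dT ltn_neqAle.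
have TTv : (T <= T + <[v]>)%VS by apply: addvSl.
rewrite (dimvS TTv) andbT; case: eqVneq => [/eqP|_ /=].
  rewrite (dimv_leqif_eq TTv) => /eqP E.
  by case/negP: vT; rewrite E (subvP (addvSr _ _)) // memv_line.
case/(_ _)/negP => //; apply/asboolP; exists (T + <[v]>)%VS; split=> // w.
by case/memv_addP => u /TP Pu [_ /vlineP [a ->] ->]; rewrite addrC; apply: PL.
Qed.

Lemma common_denominator (K F : fieldType) (c : {rmorphism K -> F}) N
    (x : 'I_N -> F) (I : finType) (y : I -> F) : generated c x ->
  exists s a, mmap c x s != 0 /\ forall i : I, mmap c x (a i) = y i * mmap c x s.
Proof.
move=> gen; have /choice [a aP] : forall i, exists a, exists b : {mpoly K[N]},
    mmap c x b != 0 /\ y i = mmap c x a / mmap c x b by move=> i; apply: gen.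
have /choice [b bP] := aP.
exists (\prod_i b i), (fun i => a i * \prod_(j | j != i) b j); split.
  rewrite rmorph_prod prodf_seq_neq0; apply/allP => i _.
  by have [] := bP i.
move=> i; have [bi ->] := bP i.
by rewrite [in RHS](bigD1 i) //= !rmorphM /= mulrA divfK.
Qed.

Section Affine.
Variables (K : closedFieldType) (E : vectType K).
Hypothesis K0 : char0 K.
Local Notation N := (\dim {:E}).
Local Notation R := {mpoly K[N]}.
Implicit Types Y : E -> Prop.

Definition crd (x : E) (i : 'I_N) : K := coord (vbasis {:E}) i x.

Definition vec (xi : 'I_N -> K) : E := \sum_i xi i *: (vbasis {:E})`_i.

Lemma crd_vec xi : crd (vec xi) =1 xi.
Proof.
move=> i; rewrite /crd /vec coord_sum_free //.
exact: (basis_free (vbasisP _)).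
Qed.

Lemma vec_crd x : vec (crd x) = x.
Proof. by rewrite [RHS](coord_vbasis (memvf x)). Qed.

Lemma crdL a u v i : crd (a *: u + v) i = a * crd u i + crd v i.
Proof. by rewrite /crd linearP. Qed.

Lemma poly_evalE (p : R) x : poly_eval p x = mmap idfun (crd x) p.
Proof. by []. Qed.

Lemma poly_eval_vec (p : R) xi : poly_eval p (vec xi) = p.@[xi].
Proof. by apply: meval_eq => i; apply: crd_vec. Qed.

Lemma poly_evalD (p q : R) x : poly_eval (p + q) x = poly_eval p x + poly_eval q x.
Proof. exact: mevalD. Qed.

Lemma poly_evalM (p q : R) x : poly_eval (p * q) x = poly_eval p x * poly_eval q x.
Proof. exact: mevalM. Qed.

Lemma algebraic_vanishing Y x : algebraic Y ->
  (forall p, vanishing_ideal Y p -> poly_eval p x = 0) -> Y x.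
Proof.
move=> [S SP] H; apply/SP => p Sp; apply: H => y /SP; exact.
Qed.

Definition prime_set Y := (exists x, Y x) /\
  forall p q, vanishing_ideal Y (p * q) ->
    vanishing_ideal Y p \/ vanishing_ideal Y q.

Definition point_of Y (F : fieldType) (c : {rmorphism K -> F}) (x : 'I_N -> F) :=
  forall p, mmap c x p = 0 <-> vanishing_ideal Y p.

(** Unlike in [dim_of], the field need not be generated by the coordinates; a specialisation
    provides only this much. *)
Definition indep_of Y k := exists (F : fieldType) (c : {rmorphism K -> F})
  (x : 'I_N -> F) (h : 'I_k -> 'I_N), point_of Y c x /\ indep c (x \o h).

Definition dim_of Y k := exists (F : fieldType) (c : {rmorphism K -> F})
  (x : 'I_N -> F) (h : 'I_k -> 'I_N),
  [/\ point_of Y c x, generated c x & basis c x h].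

Lemma prime_generic_point Y : prime_set Y ->
  exists (F : fieldType) (c : {rmorphism K -> F}) (x : 'I_N -> F),
    point_of Y c x /\ generated c x.
Proof.
move=> [[x0 Yx0] Yprime]; apply: prime_point => //.
- by move=> y _; rewrite /poly_eval rmorph0.
- by move/(_ x0 Yx0)/eqP; rewrite /poly_eval rmorph1 oner_eq0.
- by move=> a u v Iu Iv y Yy; rewrite poly_evalD poly_evalM Iu // Iv // mulr0 addr0.
Qed.

Lemma prime_dim_of Y : prime_set Y -> exists k, dim_of Y k.
Proof.
move/prime_generic_point => [F [c [x [px gx]]]].
have [k [h bh]] := exists_basis c x.
by exists k, F, c, x, h.
Qed.

Lemma dim_of_le Y k : dim_of Y k -> (k <= N)%N.
Proof. by move=> [F [c [x [h [_ _ [ih _]]]]]]; apply: indep_coord_le ih. Qed.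

Lemma dim_of_indep Y k : dim_of Y k -> indep_of Y k.
Proof. by move=> [F [c [x [h [px _ [ih _]]]]]]; exists F, c, x, h. Qed.

Lemma point_of_sub Y Y' (F L : fieldType) (c : {rmorphism K -> F})
    (d : {rmorphism K -> L}) (x : 'I_N -> F) (y : 'I_N -> L) :
  (forall z, Y' z -> Y z) -> point_of Y c x -> point_of Y' d y ->
  forall p, mmap c x p = 0 -> mmap d y p = 0.
Proof. by move=> sub px py p /px Yp; apply/py => z /sub; apply: Yp. Qed.

Lemma indep_of_dim Y Y' k t : (forall z, Y' z -> Y z) ->
  indep_of Y' k -> dim_of Y t -> (k <= t)%N.
Proof.
move=> sub [L [d [y [h [py ih]]]]] [F [c [x [h' [px gx bx]]]]].
apply: (indep_le_basis (char0_morph c K0) gx bx (z := x \o h)).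
exact: indep_specialisation (point_of_sub sub px py) ih.
Qed.

(** A polynomial [g] vanishing on [Y'] but not on [Y] takes at the generic point of [Y] a value
    independent of the lifted coordinates. *)
Lemma indep_of_proper Y Y' k : prime_set Y -> algebraic Y' ->
  (forall z, Y' z -> Y z) -> (exists z, Y z /\ ~ Y' z) ->
  indep_of Y' k -> indep_of Y k.+1.
Proof.
move=> Yp Y'a sub [z [Yz nY'z]] [L [d [y [h [py ih]]]]].
have [F [c [x [px gx]]]] := prime_generic_point Yp.
have [g [Y'g Yg]] : exists g, vanishing_ideal Y' g /\ ~ vanishing_ideal Y g.
  apply: contrapT => H; apply: nY'z; apply: algebraic_vanishing => // p Y'p.
  suff Yp' : vanishing_ideal Y p by apply: Yp'.
  by apply: contrapT => nYp; apply: H; exists p.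
have yg : mmap d y g = 0 by apply/py.
have xg : mmap c x g != 0 by apply/eqP => /px.
have iz := indep_generalisation (point_of_sub sub px py) yg xg ih.
have F0 := char0_morph c K0.
(* The value of [g] is not a coordinate; comparing with a basis of coordinates yields [k.+1]
   independent ones. *)
have [t [h' bx]] := exists_basis c x.
have kt := indep_le_basis F0 gx bx iz.
exists F, c, x, (h' \o widen_ord kt); split=> //.
apply: (indep_sub (z := x \o h')) bx.1 => i j /(congr1 val) /= ij.
exact: val_inj.
Qed.

Lemma chain_indep (C : nat -> E -> Prop) d :
  (forall i, (i <= d)%N -> algebraic (C i) /\ prime_set (C i)) ->
  (forall i, (i < d)%N -> (forall z, C i z -> C i.+1 z) /\
     exists z, C i.+1 z /\ ~ C i z) -> indep_of (C d) d.
Proof.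
elim: d => [|d IHd] Ca Cs.
  have [F [c [x [px gx]]]] := prime_generic_point (Ca 0 isT).2.
  have h0 : 'I_0 -> 'I_N by case.
  by exists F, c, x, h0; split=> //; apply: indep0.
have [sub ex] := Cs d (ltnSn d).
apply: (indep_of_proper _ _ sub ex).
- by have [] := Ca d.+1 (leqnn _).
- by have [] := Ca d (leqnSn _).
by apply: IHd => i id; [apply: Ca; apply: leqW | apply: Cs; apply: leqW].
Qed.

(* By the Nullstellensatz, the zero set of the relations of a point [y] has
   exactly these relations as its vanishing ideal. *)
Lemma locus_point (L : fieldType) (d : {rmorphism K -> L}) (y : 'I_N -> L) :
  exists Y, [/\ algebraic Y, prime_set Y & point_of Y d y].
Proof.
pose Y z := forall p : R, mmap d y p = 0 -> poly_eval p z = 0.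
have pY : point_of Y d y.
  move=> p; split=> [p0 z|Yp]; first exact.
  apply/eqP; apply: contraT => yp.
  have [xi [xiP /eqP []]] := closed_specialisation K0 yp.
  by rewrite -poly_eval_vec; apply: Yp => q /xiP; rewrite poly_eval_vec.
exists Y; split=> //; first by exists (fun p => mmap d y p = 0).
split.
  have [|xi [xiP _]] := @closed_specialisation K L d N y 1 K0.
    by rewrite rmorph1 oner_neq0.
  by exists (vec xi) => p /xiP; rewrite poly_eval_vec.
move=> p q /pY /eqP; rewrite rmorphM mulf_eq0.
by case/orP => /eqP /pY; [left | right].
Qed.

Lemma proper_subset_indep Y k : algebraic Y -> indep_of Y k.+1 ->
  exists Y', [/\ algebraic Y' /\ prime_set Y',
    forall z, Y' z -> Y z, exists z, Y z /\ ~ Y' z & indep_of Y' k].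
Proof.
move=> Ya [F [c [x [h [px ih]]]]].
have [L [d [y [h' [xy [p [yp xp]] ih']]]]] := proper_specialisation K0 ih.
have [Y' [Y'a Y'p py]] := locus_point d y.
have sub z : Y' z -> Y z.
  move=> Y'z; apply: algebraic_vanishing => // q /px /xy /py; exact.
exists Y'; split=> //; last by exists L, d, y, h'.
apply: contrapT => H; move/eqP: xp; apply; apply/px => z Yz.
by apply: (proj1 (py p) yp); apply: contrapT => nY'z; apply: H; exists z.
Qed.

Lemma chain_below_indep Y k : algebraic Y -> prime_set Y -> indep_of Y k ->
  exists C : nat -> E -> Prop,
  [/\ forall i, (i <= k)%N -> algebraic (C i) /\ prime_set (C i),
      forall i, (i < k)%N -> (forall z, C i z -> C i.+1 z) /\
        exists z, C i.+1 z /\ ~ C i z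
    & C k = Y].
Proof.
elim: k Y => [|k IHk] Y Ya Yp Yk.
  by exists (fun _ => Y); split=> // i; rewrite leqn0 => /eqP ->.
have [Y' [[Y'a Y'p] sub ex Y'k]] := proper_subset_indep Ya Yk.
have [C [Ca Cs Ck]] := IHk Y' Y'a Y'p Y'k.
exists (fun i => if (i <= k)%N then C i else Y); split=> [i|i|].
- by case: (leqP i k) => [ik _|//]; apply: Ca.
- rewrite ltnS => ik; rewrite ik; case: ltnP => [ik'|ki]; first exact: Cs.
  have -> : i = k by apply/eqP; rewrite eqn_leq ik.
  by rewrite Ck.
- by rewrite ltnn.
Qed.

(** * Tangent spaces near the generic point *)

Section GenericTangent.
Variables (Y : E -> Prop) (F : fieldType) (c : {rmorphism K -> F}) (x : 'I_N -> F).
Hypotheses (px : point_of Y c x) (gx : generated c x).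

(** Cleared of denominators, [D] is a polynomial vector field. For [p] in the ideal, [D] applied to
    the relation [p(x) = 0] is a relation of the generic point, so it holds at every point of
    [Y]. *)
Lemma vector_field_tangent (D : F -> F) (s : R) (a : 'I_N -> R) xi :
  der_over c D -> (forall i, mmap c x (a i) = D (x i) * mmap c x s) ->
  Y xi -> zariski_tangent Y xi (vec (fun i => poly_eval (a i) xi)).
Proof.
move=> [dD Dc] aP Yxi p Yp.
have : vanishing_ideal Y (\sum_i mderiv i p * a i).
  apply/px; rewrite rmorph_sum /=.
  have := der_mmap (f := idfun) x p dD Dc.
  have -> : mmap c x p = 0 by apply/px.
  rewrite (der0 dD) => /(congr1 (fun y => y * mmap c x s)); rewrite mul0r => E0.
  rewrite [RHS]E0 /diff_at mulr_suml; apply: eq_bigr => i _.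
  by rewrite rmorphM /= aP mulrA.
move/(_ xi Yxi); rewrite /poly_eval rmorph_sum => <-.
rewrite /poly_diff; apply: eq_bigr => i _; rewrite rmorphM /=.
by rewrite -/(crd _ _) crd_vec.
Qed.

Lemma zariski_tangent0 xi : zariski_tangent Y xi 0.
Proof.
move=> p _; rewrite /poly_diff big1 // => i _.
by rewrite linear0 mulr0.
Qed.

Lemma zariski_tangentL xi a u v : zariski_tangent Y xi u ->
  zariski_tangent Y xi v -> zariski_tangent Y xi (a *: u + v).
Proof.
move=> Tu Tv p Yp.
have -> : poly_diff p xi (a *: u + v) = a * poly_diff p xi u + poly_diff p xi v.
  rewrite /poly_diff mulr_sumr -big_split; apply: eq_bigr => i _ /=.
  by rewrite linearP /=; ring.
by rewrite Tu // Tv // mulr0 addr0.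
Qed.

(** Projection to the basis coordinates is an isomorphism on the tangent space where [s] is nonzero.
    It is injective because the derivatives of the minimal relations do not vanish, and surjective
    because the derivations dual to the basis give tangent vector fields. *)
Lemma generic_tangent_dim t (h : 'I_t -> 'I_N) : basis c x h ->
  exists s : R, mmap c x s != 0 /\ forall xi, Y xi -> poly_eval s xi != 0 ->
    exists T : {vspace E}, (forall v, v \in T <-> zariski_tangent Y xi v) /\
      \dim T = t.
Proof.
move=> bx; have F0 := char0_morph c K0; have [ih algh] := bx.
have /choice [D DP] : forall j : 'I_t, exists D : F -> F, [/\ is_der idfun D,
    forall a, D (c a) = 0 & forall i, D (x (h i)) = (j == i)%:R].
  by move=> j; apply: (exists_der F0 gx).
have [s0 [a [s0n aP]]] := common_denominator (fun ji : 'I_t * 'I_N => D ji.1 (x ji.2)) gx.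
have /choice [m mP] := algh.
pose sub : {mpoly K[t]} -> R := mmap (@mpolyC N K) (fun j => 'X_(h j)).
pose rel i : R := (map_poly sub (m i)).['X_i].
pose drel i : R := (map_poly sub (m i)^`()).['X_i].
have evrel P i : mmap c x (map_poly sub P).['X_i] = eval_at (mmap c (x \o h)) (x i) P.
  rewrite -horner_map /= mmapXU -map_poly_comp eval_atE; congr (_.[_]).
  by apply: eq_map_poly => q; apply: mmap_subvars.
have relI i : vanishing_ideal Y (rel i).
  by apply/px; rewrite evrel; have [] := mP i.
exists (s0 * \prod_i drel i); split.
  rewrite rmorphM mulf_neq0 // rmorph_prod prodf_seq_neq0; apply/allP => i _ /=.
  by rewrite evrel; apply: min_relation_deriv F0.
move=> xi Yxi; rewrite poly_evalM mulf_eq0 negb_or => /andP [s0xi dxi].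
have drel0 i : poly_eval (drel i) xi != 0.
  move: dxi; rewrite /poly_eval rmorph_prod prodf_seq_neq0 => /allP /(_ i).
  by rewrite mem_index_enum => /(_ isT).
have [T TP] := vspace_of_closed (zariski_tangent0 xi) (@zariski_tangentL xi).
exists T; split=> //.
pose g : E -> 'rV[K]_t := fun v => \row_j crd v (h j).
have gL : linear g by move=> b u v; apply/rowP => j; rewrite !mxE crdL.
pose gm := GRing.isLinear.Build K E 'rV[K]_t _ g gL.
pose gl : {linear E -> 'rV[K]_t} := HB.pack g gm.
have gE v : linfun gl v = g v by rewrite lfunE.
have injg : (T :&: lker (linfun gl) = 0)%VS.
  apply/eqP; rewrite -subv0; apply/subvP => v; rewrite memv_cap memv_ker memv0.
  rewrite gE => /andP [/TP Tv /eqP /rowP gv0].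
  have v0 j : crd v (h j) = 0 by have := gv0 j; rewrite !mxE.
  suff v0' i : crd v i = 0.
    by rewrite -[v]vec_crd /vec big1 // => i _; rewrite v0' scale0r.
  have dD := diff_at_der idfun (crd xi) (crd v).
  have D0 : diff_at idfun (crd xi) (crd v) (rel i) = 0 by exact: Tv.
  move: D0; rewrite /rel (der_horner dD) => [|l].
    rewrite deriv_map horner_map diff_atX /= => /eqP.
    by rewrite mulf_eq0 -poly_evalE (negPf (drel0 i)) => /eqP.
  rewrite coef_map /= /sub (der_mmap _ _ dD) => [|b]; last by rewrite diff_atC.
  by rewrite /diff_at big1 // => j _ /=; rewrite -/(diff_at _ _ _ _) diff_atX v0 mulr0.
rewrite -(limg_dim_eq injg).
suff -> : (linfun gl @: T = fullv)%VS by rewrite dimvf /dim /= mul1n.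
apply/eqP; rewrite eqEsubv subvf; apply/subvP => w _.
rewrite [w]row_sum_delta; apply: memv_suml => j _; apply: memvZ.
pose w' := vec (fun i => poly_eval (a (j, i)) xi).
have -> : delta_mx 0 j = linfun gl ((poly_eval s0 xi)^-1 *: w').
  rewrite linearZ /= gE; apply/rowP => j'; rewrite !mxE crd_vec.
  have : vanishing_ideal Y (a (j, h j') - (j == j')%:R%:MP * s0).
    apply/px; rewrite rmorphB rmorphM /= aP mmapC /=.
    by have [_ _ ->] := DP j; rewrite rmorph_nat subrr.
  move/(_ xi Yxi)/eqP; rewrite /poly_eval rmorphB subr_eq0 rmorphM /= mevalC.
  by move/eqP => ->; rewrite mulrCA mulVf // mulr1 eq_sym.
apply: memv_img; apply: memvZ; apply/TP.
apply: (vector_field_tangent (D := D j) (s := s0)) => //.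
  by have [] := DP j.
Qed.

(** * The generic matrix and its pencil *)

Section Pencil.
Variables (a b : nat) (m : {linear E -> 'M[K]_(a, b)}).
Hypothesis m_inj : injective m.
Local Notation e i := (vbasis {:E})`_(nat_of_ord i).

Definition entry (y : 'I_N -> R) p q : R := \sum_i (m (e i) p q) *: y i.

Lemma entry_eval (y : 'I_N -> R) p q xi :
  poly_eval (entry y p q) xi = m (vec (fun i => poly_eval (y i) xi)) p q.
Proof.
rewrite /poly_eval /entry /vec rmorph_sum linear_sum summxE /=.
by apply: eq_bigr => i _; rewrite mevalZ linearZ mxE mulrC.
Qed.

Lemma entryX_eval p q xi : poly_eval (entry (fun i => 'X_i) p q) xi = m xi p q.
Proof.
rewrite entry_eval -{2}[xi]vec_crd; congr (m (vec _) p q).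
by apply: funext => i; rewrite /poly_eval mevalXU.
Qed.

Lemma crd_entries : exists kap : 'I_N -> 'I_a -> 'I_b -> K, forall i v,
  crd v i = \sum_p \sum_q kap i p q * m v p q.
Proof.
pose f := linfun m; have kf : lker f == 0%VS.
  by apply/lker0P => u v; rewrite !lfunE => /m_inj.
exists (fun i p q => crd ((f^-1)%VF (delta_mx p q)) i) => i v.
rewrite -{1}[v](lker0_lfunK kf) lfunE /=.
rewrite [in LHS](matrix_sum_delta (m v)) /crd !linear_sum /=.
apply: eq_bigr => p _; rewrite !linear_sum; apply: eq_bigr => q _ /=.
by rewrite !linearZ /= mulrC.
Qed.

Lemma crd_basis i l : crd (e l) i = (i == l)%:R.
Proof. by rewrite /crd coord_free ?(basis_free (vbasisP _)) // eq_sym. Qed.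

Let X p q := mmap c x (entry (fun i => 'X_i) p q).

Lemma der_entry D p q : der_over c D ->
  D (X p q) = \sum_i c (m (e i) p q) * D (x i).
Proof.
move=> [dD Dc]; rewrite /X /entry rmorph_sum (der_sum dD) /=.
apply: eq_bigr => i _.
by rewrite mmapZ mmapXU dD.2 Dc mulr0 addr0.
Qed.

(** After clearing denominators, a minor of [D X] is a polynomial vanishing on [Y] wherever [s] does
    not; multiplied by [s] it vanishes on all of [Y], hence at the generic point. *)
Lemma rank1_ders_of_tangents :
  (exists s : R, mmap c x s != 0 /\ forall xi, Y xi -> poly_eval s xi != 0 ->
    forall v, zariski_tangent Y xi v ->
    forall p q p' q', m v p q * m v p' q' = m v p q' * m v p' q) ->
  rank1_ders c X.
Proof.
move=> [s [s0 sP]] D dD p q p' q'.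
have [d [y [d0 yP]]] := common_denominator (fun i => D (x i)) gx.
have entryE i j : mmap c x (entry y i j) = D (X i j) * mmap c x d.
  rewrite der_entry // mulr_suml /entry rmorph_sum; apply: eq_bigr => l _ /=.
  by rewrite mmapZ yP mulrA.
have : mmap c x (s * (entry y p q * entry y p' q' - entry y p q' * entry y p' q)) = 0.
  apply/px => xi Yxi; rewrite poly_evalM.
  have [->|sxi] := eqVneq (poly_eval s xi) 0; first by rewrite mul0r.
  rewrite /poly_eval rmorphB !rmorphM /= -!/(poly_eval _ _) !entry_eval.
  rewrite (sP _ Yxi sxi) ?subrr ?mulr0 //.
  exact: (vector_field_tangent dD yP Yxi).
rewrite rmorphM rmorphB !rmorphM /= !entryE => /eqP.
rewrite mulf_eq0 (negPf s0) subr_eq0 /= => /eqP H.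
apply: (mulIf d0); apply: (mulIf d0).
transitivity (D (X p q) * mmap c x d * (D (X p' q') * mmap c x d)); first ring.
rewrite H; ring.
Qed.

Lemma isotropic_pencil t (h : 'I_t -> 'I_N) : basis c x h -> (1 < t)%N -> Y 0 ->
  rank1_ders c X ->
  (exists p0 (u : 'I_a -> K), u p0 = 1 /\
     forall xi, Y xi -> forall p q, m xi p q = u p * m xi p0 q) \/
  (exists q0 (u : 'I_b -> K), u q0 = 1 /\
     forall xi, Y xi -> forall p q, m xi p q = u q * m xi p q0).
Proof.
move=> [ih _] t1 Y0 r1; have F0 := char0_morph c K0.
have der_dual (j : 'I_t) : exists D, der_over c D /\
    forall i, D (x (h i)) = (j == i)%:R.
  have [D [dD Dc DE]] := exists_der F0 gx (fun i => (j == i)%:R) ih.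
  by exists D.
have [D1 [d1 E1]] := der_dual (Ordinal (ltnW t1)).
have [D2 [d2 E2]] := der_dual (Ordinal t1).
have [kap kapP] := crd_entries.
have DxE D i : der_over c D ->
    D (x i) = \sum_p \sum_q c (kap i p q) * D (X p q).
  move=> dD; transitivity (\sum_l c (i == l)%:R * D (x l)).
    rewrite (bigD1 i) //= eqxx rmorph1 mul1r big1 ?addr0 // => l li.
    by rewrite eq_sym (negPf li) rmorph0 mul0r.
  under eq_bigr => l _ do rewrite -crd_basis kapP rmorph_sum mulr_suml.
  rewrite exchange_big; apply: eq_bigr => p _ /=.
  under eq_bigr => l _ do rewrite rmorph_sum mulr_suml.
  rewrite exchange_big; apply: eq_bigr => q _ /=.
  rewrite der_entry // mulr_sumr; apply: eq_bigr => l _.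
  by rewrite rmorphM mulrA.
(* The coordinates are linear combinations of the entries, so a dependence between the two matrices
   would persist on the coordinates to which [D1] and [D2] are dual. *)
have ind r s : (forall p q, r * D1 (X p q) = s * D2 (X p q)) -> r = 0 /\ s = 0.
  move=> H; have Hx i : r * D1 (x i) = s * D2 (x i).
    rewrite !DxE // !mulr_sumr; apply: eq_bigr => p _.
    rewrite !mulr_sumr; apply: eq_bigr => q _.
    by rewrite mulrCA H mulrCA.
  split.
    by have := Hx (h (Ordinal (ltnW t1))); rewrite E1 E2 mulr1 mulr0.
  by have := Hx (h (Ordinal t1)); rewrite E1 E2 mulr1 mulr0.
have cst y : (forall D, der_over c D -> D y = 0) -> exists k, y = c k.
  move=> Dy; apply: (constants F0 gx) => [p sp|D dD Dc].
    by apply/closed_rootP; rewrite neq_ltn sp orbT.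
  by apply: Dy.
have XE p q p' q' k l : X p q = c k * X p' q' + c l ->
    forall xi, Y xi -> m xi p q = k * m xi p' q'.
  move=> XX; pose g : R := entry (fun i => 'X_i) p q
    - k%:MP * entry (fun i => 'X_i) p' q' - l%:MP.
  have gY : vanishing_ideal Y g.
    apply/px; rewrite /g !rmorphB rmorphM /= !mmapC /= -/(X p q) -/(X p' q') XX.
    ring.
  have gE xi : poly_eval g xi = m xi p q - k * m xi p' q' - l.
    rewrite /g /poly_eval !rmorphB rmorphM /= !mevalC -!/(poly_eval _ _).
    by rewrite !entryX_eval.
  (* The zero matrix belongs to the variety, which removes the additive constant of integration. *)
  have l0 : l = 0.
    have := gY 0 Y0; rewrite gE linear0 !mxE mulr0 subrr sub0r => /eqP.
    by rewrite oppr_eq0 => /eqP.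
  by move=> xi Yxi; have := gY xi Yxi; rewrite gE l0 subr0 => /subr0_eq.
have [[p0 [u [d [u1 ud]]]]|[q0 [u [d [u1 ud]]]]] := integrate_rank1 cst r1 d1 d2 ind.
  by left; exists p0, u; split=> // xi Yxi p q; apply: XE (ud p q) _ Yxi.
by right; exists q0, u; split=> // xi Yxi p q; apply: XE (ud q p) _ Yxi.
Qed.

End Pencil.

End GenericTangent.

End Affine.

(** * Coordinates adapted to a chart *)

Lemma dim_le1_line (K : fieldType) (V : vectType K) (S : {vspace V}) :
  (\dim S <= 1)%N -> exists z, (S <= <[z]>)%VS.
Proof.
move=> dS; have [->|S0] := eqVneq S 0%VS; first by exists 0; apply: sub0v.
have H : (<[vpick S]> <= S)%VS by rewrite -memvE memv_pick.
exists (vpick S); rewrite -(geq_leqif (dimv_leqif_sup H)).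
by rewrite dim_vline vpick0 S0.
Qed.

Section Frames.
Variables (K : fieldType) (n : nat).
Local Notation V := 'rV[K]_n.
Implicit Types U : {vspace V}.

Lemma subspace_coordinates U d : \dim U = d ->
  exists (B : 'M[K]_(d, n)) (co : {linear subvs_of U -> 'rV[K]_d})
    (el : {linear 'rV[K]_d -> subvs_of U}),
  [/\ cancel co el, cancel el co & forall r, vsval (el r) = r *m B].
Proof.
move=> <-.
pose B : 'M[K]_(\dim U, n) := \matrix_i (vbasis U)`_i.
pose co (u : subvs_of U) : 'rV[K]_(\dim U) := \row_i coord (vbasis U) i (vsval u).
have coL : linear co.
  by move=> a u v; apply/rowP => i; rewrite !mxE linearP.
pose com := GRing.isLinear.Build _ _ _ _ co coL.
pose col : {linear subvs_of U -> 'rV[K]_(\dim U)} := HB.pack co com.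
pose el (r : 'rV[K]_(\dim U)) : subvs_of U := vsproj U (r *m B).
have elL : linear el.
  by move=> a u v; rewrite /el mulmxDl -scalemxAl linearP.
pose elm := GRing.isLinear.Build _ _ _ _ el elL.
pose ell : {linear 'rV[K]_(\dim U) -> subvs_of U} := HB.pack el elm.
have mulB (r : 'rV[K]_(\dim U)) : r *m B = \sum_i r 0 i *: (vbasis U)`_i.
  by rewrite mulmx_sum_row; apply: eq_bigr => i _; rewrite rowK.
have elE r : vsval (el r) = r *m B.
  rewrite /el vsprojK // mulB; apply: memv_suml => i _; apply: memvZ.
  by apply: vbasis_mem; rewrite mem_nth // size_tuple.
exists B, col, ell; split=> // [u|r] /=.
  apply: subvs_inj; rewrite elE mulB [RHS](coord_vbasis (subvsP u)).
  by apply: eq_bigr => i _; rewrite mxE.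
apply/rowP => i; rewrite mxE elE mulB coord_sum_free //.
exact: (basis_free (vbasisP U)).
Qed.

(* A basis of [K^n] adapted to the splitting by [U] and [U^C]: the rows of [B]
   and [C] are the two parts of the basis, [Qa] and [Qb] are the coordinates. *)
Record frame U a b (B : 'M[K]_(a, n)) (C : 'M[K]_(b, n)) (Qa : 'M[K]_(n, a))
    (Qb : 'M[K]_(n, b)) (m : {linear hom_quot U -> 'M[K]_(a, b)}) : Prop := Frame {
  frame_BQa : B *m Qa = 1%:M;
  frame_BQb : B *m Qb = 0;
  frame_CQa : C *m Qa = 0;
  frame_CQb : C *m Qb = 1%:M;
  frame_sum : Qa *m B + Qb *m C = 1%:M;
  frame_inj : injective m;
  frame_surj : forall M, exists f, m f = M;
  frame_graph : forall f u, u \in graph f <-> exists r : 'rV_a, u = r *m (B + m f *m C);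
  frame_rank : forall f, (hom_rank f <= 1)%N <->
    exists (w : 'cV_a) (r : 'rV_b), m f = w *m r
}.

Definition graph_mx U a b (B : 'M[K]_(a, n)) (C : 'M[K]_(b, n))
  (m : {linear hom_quot U -> 'M[K]_(a, b)}) f := B + m f *m C.

Section GraphMatrix.
Variables (U : {vspace V}) (a b : nat) (B : 'M[K]_(a, n)) (C : 'M[K]_(b, n)).
Variables (Qa : 'M[K]_(n, a)) (Qb : 'M[K]_(n, b)).
Variable m : {linear hom_quot U -> 'M[K]_(a, b)}.
Hypothesis fr : frame B C Qa Qb m.

Lemma graph_mxQa f : graph_mx B C m f *m Qa = 1%:M.
Proof. by rewrite mulmxDl (frame_BQa fr) -mulmxA (frame_CQa fr) mulmx0 addr0. Qed.

Lemma graph_mxQb f : graph_mx B C m f *m Qb = m f.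
Proof. by rewrite mulmxDl (frame_BQb fr) -mulmxA (frame_CQb fr) mulmx1 add0r. Qed.

Lemma memv_graph f w : w \in graph f <-> w *m Qb = w *m Qa *m m f.
Proof.
split=> [/(frame_graph fr) [r ->]|E]; last first.
  apply/(frame_graph fr); exists (w *m Qa).
  by rewrite mulmxDr mulmxA -E -!mulmxA -mulmxDr (frame_sum fr) mulmx1.
by rewrite -/(graph_mx B C m f) -!mulmxA graph_mxQb [_ *m (Qa *m _)]mulmxA graph_mxQa mul1mx.
Qed.

End GraphMatrix.

Lemma frame_exists U a b : \dim U = a -> \dim U^C = b ->
  exists B C Qa Qb m, @frame U a b B C Qa Qb m.
Proof.
move=> dU dC.
have [B [co [el [coK elK elE]]]] := subspace_coordinates dU.
have [C [co' [el' [co'K el'K el'E]]]] := subspace_coordinates dC.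
have BU r : r *m B \in U by rewrite -elE; apply: subvsP.
have CU r : r *m C \in U^C%VS by rewrite -el'E; apply: subvsP.
pose pa (v : V) := co (vsproj U (projv U v)).
pose pb (v : V) := co' (vsproj U^C%VS (v - projv U v)).
have paL : linear pa by move=> k u v; rewrite /pa !linearP.
have pbL : linear pb.
  move=> k u v; rewrite /pb -!linearP; congr (co' (_ _)) => /=.
  by rewrite linearP /= scalerBr opprD addrACA.
pose pam := GRing.isLinear.Build _ _ _ _ pa paL.
pose pal : {linear V -> 'rV[K]_a} := HB.pack pa pam.
pose pbm := GRing.isLinear.Build _ _ _ _ pb pbL.
pose pbl : {linear V -> 'rV[K]_b} := HB.pack pb pbm.
pose Qa := lin1_mx pal; pose Qb := lin1_mx pbl.
have QaE v : v *m Qa = pa v by rewrite mul_rV_lin1.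
have QbE v : v *m Qb = pb v by rewrite mul_rV_lin1.
have projU u : u \in U -> projv U u = u by apply: projv_id.
have projC u : u \in U^C%VS -> projv U u = 0.
  by rewrite -lker_proj memv_ker => /eqP.
have rowE p q (M M' : 'M[K]_(p, q)) : (forall r : 'rV_p, r *m M = r *m M') -> M = M'.
  by move=> H; apply/row_matrixP => i; rewrite !rowE H.
pose mm (f : hom_quot U) : 'M[K]_(a, b) := \matrix_i
  co' ((f : 'Hom(subvs_of U, subvs_of U^C%VS)) (el (delta_mx 0 i))).
have mL : linear mm.
  move=> k f g; apply/row_matrixP => i.
  by rewrite linearP /= !rowK add_lfunE scale_lfunE linearP.
pose mlm := GRing.isLinear.Build _ _ _ _ mm mL.
pose ml : {linear hom_quot U -> 'M[K]_(a, b)} := HB.pack mm mlm.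
have mE (f : hom_quot U) r : r *m mm f =
    co' ((f : 'Hom(subvs_of U, subvs_of U^C%VS)) (el r)).
  rewrite [in RHS](row_sum_delta r) !linear_sum mulmx_sum_row /=.
  by apply: eq_bigr => i _; rewrite rowK !linearZ.
have mE' (f : hom_quot U) u : (f : 'Hom(subvs_of U, subvs_of U^C%VS)) u
    = el' (co u *m mm f) by rewrite mE coK co'K.
exists B, C, Qa, Qb, ml; split.
- apply: rowE => r; rewrite mulmxA QaE mulmx1 /pa projU //.
  by rewrite -elE vsvalK elK.
- apply: rowE => r; rewrite mulmxA QbE mulmx0 /pb projU // subrr !linear0 //.
- apply: rowE => r; rewrite mulmxA QaE mulmx0 /pa projC // !linear0 //.
- apply: rowE => r; rewrite mulmxA QbE mulmx1 /pb projC // subr0.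
  by rewrite -el'E vsvalK el'K.
- apply: rowE => r; rewrite mulmxDr !mulmxA QaE QbE mulmx1 /pa /pb.
  rewrite -elE -el'E coK co'K !vsprojK ?memv_proj ?memv_projC //.
  by rewrite addrC subrK.
- move=> f g fg; apply/lfunP => u; rewrite (mE' f) (mE' g).
  by rewrite (fg : mm f = mm g).
- move=> M; pose f u := el' (co u *m M).
  have fL : linear f by move=> k u v; rewrite /f linearP mulmxDl -scalemxAl linearP.
  pose fm := GRing.isLinear.Build _ _ _ _ f fL.
  pose fl : {linear subvs_of U -> subvs_of U^C%VS} := HB.pack f fm.
  exists (linfun fl : 'Hom(subvs_of U, subvs_of U^C%VS)).
  by apply: rowE => r; rewrite mE lfunE /= /f elK el'K.
- move=> f u; split.
    case/memv_imgP => w _ ->; exists (co w); rewrite graph_mapE mE'.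
    by rewrite el'E mulmxDr -elE coK mulmxA.
  case=> r ->; apply/memv_imgP; exists (el r); first exact: memvf.
  by rewrite graph_mapE mE' elK elE el'E mulmxDr mulmxA.
- move=> f; rewrite /hom_rank; set g : 'Hom(_, _) := f; split=> [rk|[w [r mf]]].
    have [z zP] := dim_le1_line rk.
    have /choice [k kP] : forall i, exists k, g (el (delta_mx 0 i)) = k *: z.
      by move=> i; apply/vlineP/(subvP zP)/memv_img/memvf.
    exists (\col_i k i), (co' z); apply/row_matrixP => i.
    rewrite rowK kP linearZ row_mul /=.
    by rewrite [row i (\col_i0 _)]mx11_scalar mul_scalar_mx !mxE.
  have : (limg g <= <[el' r]>)%VS.
    apply/subvP => _ /memv_imgP [u _ ->]; apply/vlineP.
    exists ((co u *m w) 0 0); rewrite mE' (mf : mm f = _) mulmxA.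
    by rewrite {1}[co u *m w]mx11_scalar mul_scalar_mx linearZ.
  by move/dimvS => /leq_trans; apply; rewrite dim_vline leq_b1.
Qed.

End Frames.

(** * Transition maps between charts *)

Section PolyDiff.
Variables (K : closedFieldType) (E : vectType K).
Local Notation R := {mpoly K[\dim {:E}]}.
Implicit Types (p q : R) (x v : E).

Lemma poly_diff_der x v :
  is_der (mmap idfun (crd x)) (fun p : R => poly_diff p x v).
Proof. exact: diff_at_der. Qed.

Lemma poly_diffD p q x v : poly_diff (p + q) x v = poly_diff p x v + poly_diff q x v.
Proof. exact: (poly_diff_der x v).1. Qed.

Lemma poly_diffM p q x v : poly_diff (p * q) x v =
  poly_eval p x * poly_diff q x v + poly_eval q x * poly_diff p x v.
Proof. exact: (poly_diff_der x v).2. Qed.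

Lemma poly_diffC a x v : poly_diff a%:MP x v = 0 :> K.
Proof. exact: diff_atC. Qed.

Lemma poly_diffX i x v : poly_diff ('X_i : R) x v = crd v i.
Proof. exact: diff_atX. Qed.

Lemma poly_diff_sum (I : Type) (r : seq I) (P : pred I) (G : I -> R) x v :
  poly_diff (\sum_(i <- r | P i) G i) x v = \sum_(i <- r | P i) poly_diff (G i) x v.
Proof. exact: (der_sum (poly_diff_der x v)). Qed.

Lemma poly_evalXn p k x : poly_eval (p ^+ k) x = poly_eval p x ^+ k.
Proof. exact: (rmorphXn (meval (crd x))). Qed.

Lemma poly_diff_exp p k x v :
  poly_eval p x * poly_diff (p ^+ k) x v =
  k%:R * poly_eval p x ^+ k * poly_diff p x v.
Proof.
elim: k => [|k IHk].
  by rewrite expr0 -mpolyC1 poly_diffC !mul0r mulr0.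
rewrite exprS poly_diffM mulrDr mulrCA IHk poly_evalXn -natr1 exprS; ring.
Qed.

End PolyDiff.

Section Homogenize.
Variables (K : closedFieldType) (E E' : vectType K).
Local Notation R := {mpoly K[\dim {:E}]}.
Local Notation R' := {mpoly K[\dim {:E'}]}.
Variables (s : R) (gam : 'I_(\dim {:E'}) -> R).

Definition rational_image (g : E) (g' : E') :=
  poly_eval s g != 0 /\ forall i, crd g' i * poly_eval s g = poly_eval (gam i) g.

(** The quotient rule for [gam / s], cleared of its denominator. *)
Definition rational_diff (g v : E) (v' : E') := forall i,
  crd v' i * poly_eval s g ^+ 2 =
  poly_diff (gam i) g v * poly_eval s g - poly_eval (gam i) g * poly_diff s g v.

(* [H = s ^ M * h (gam / s)]; the second clause is the differential of this
   identity, multiplied by [s] to avoid the exponent [M - 1]. *)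
Definition homogenized (h : R') M (H : R) :=
  (forall g g', rational_image g g' ->
     poly_eval H g = poly_eval s g ^+ M * poly_eval h g') /\
  (forall g g' v v', rational_image g g' -> rational_diff g v v' ->
     poly_eval s g * poly_diff H g v = poly_eval s g ^+ M.+1 * poly_diff h g' v' +
       M%:R * poly_eval s g ^+ M * poly_diff s g v * poly_eval h g').

Lemma homogenize (h : R') : exists M H, homogenized h M H.
Proof.
move: h; apply: mpoly_ind_ring => [a|i|p q [M1 [H1 [e1 d1]]] [M2 [H2 [e2 d2]]]
                                   |p q [M1 [H1 [e1 d1]]] [M2 [H2 [e2 d2]]]].
- exists 0%N, a%:MP; split=> [g g' _|g g' v v' _ _].
    by rewrite /poly_eval !mevalC expr0 mul1r.
  by rewrite !poly_diffC !mulr0 !mul0r addr0.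
- exists 1%N, (gam i); split=> [g g' [s0 rel]|g g' v v' [s0 rel] drel].
    by rewrite -rel [RHS]mulrC /poly_eval mevalXU expr1.
  rewrite poly_diffX [_ ^+ 2 * _]mulrC drel -rel /poly_eval mevalXU.
  rewrite -/(crd g' i); ring.
- exists (M1 + M2)%N, (s ^+ M2 * H1 + s ^+ M1 * H2).
  split=> [g g' im|g g' v v' im drel].
    rewrite !(poly_evalD, poly_evalM, poly_evalXn).
    rewrite (e1 g g') // (e2 g g') // exprD; ring.
  rewrite !poly_diffD !poly_diffM !poly_evalXn.
  have d1' := d1 _ _ _ _ im drel; have d2' := d2 _ _ _ _ im drel.
  have E1 := poly_diff_exp s M1 g v; have E2 := poly_diff_exp s M2 g v.
  move: d1' d2' E1 E2; rewrite (e1 g g') // (e2 g g') //.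
  set S := poly_eval s g; set dS := poly_diff s g v.
  move=> d1' d2' E1 E2.
  rewrite [LHS](_ : _ = S ^+ M2 * (S * poly_diff H1 g v)
    + S ^+ M1 * poly_eval p g' * (S * poly_diff (s ^+ M2) g v)
    + (S ^+ M1 * (S * poly_diff H2 g v)
    + S ^+ M2 * poly_eval q g' * (S * poly_diff (s ^+ M1) g v))); last ring.
  rewrite d1' d2' E1 E2 natrD !exprS exprD; ring.
- exists (M1 + M2)%N, (H1 * H2).
  split=> [g g' im|g g' v v' im drel].
    rewrite poly_evalM.
    rewrite (e1 g g') // (e2 g g') // exprD; ring.
  have d1' := d1 _ _ _ _ im drel; have d2' := d2 _ _ _ _ im drel.
  rewrite !poly_diffM poly_evalM mulrDr mulrCA d2' [X in _ + X]mulrCA d1'.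
  rewrite (e1 g g') // (e2 g g') // natrD !exprS exprD; ring.
Qed.

End Homogenize.
Section Transition.
Variables (K : closedFieldType) (n a b : nat) (U U' : {vspace 'rV[K]_n}).
Variables (B : 'M[K]_(a, n)) (C : 'M[K]_(b, n)) (Qa : 'M[K]_(n, a))
  (Qb : 'M[K]_(n, b)) (m : {linear hom_quot U -> 'M[K]_(a, b)}).
Variables (B' : 'M[K]_(a, n)) (C' : 'M[K]_(b, n)) (Qa' : 'M[K]_(n, a))
  (Qb' : 'M[K]_(n, b)) (m' : {linear hom_quot U' -> 'M[K]_(a, b)}).
Hypotheses (fr : frame B C Qa Qb m) (fr' : frame B' C' Qa' Qb' m').
Local Notation E := (hom_quot U).
Local Notation E' := (hom_quot U').
Local Notation R := {mpoly K[\dim {:E}]}.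
Local Notation R' := {mpoly K[\dim {:E'}]}.
Implicit Types (f g v : E).

Definition evmx p q f (A : 'M[R]_(p, q)) : 'M[K]_(p, q) :=
  map_mx (meval (crd f)) A.
Definition dermx p q f v (A : 'M[R]_(p, q)) : 'M[K]_(p, q) :=
  map_mx (fun h : R => poly_diff h f v) A.
Definition cstmx p q (A : 'M[K]_(p, q)) : 'M[R]_(p, q) := map_mx (@mpolyC _ K) A.

Lemma evmx_cst p q f (A : 'M[K]_(p, q)) : evmx f (cstmx A) = A.
Proof. by apply/matrixP => i j; rewrite !mxE mevalC. Qed.

Lemma dermx_cst p q f v (A : 'M[K]_(p, q)) : dermx f v (cstmx A) = 0.
Proof. by apply/matrixP => i j; rewrite !mxE poly_diffC. Qed.

Lemma dermxD p q f v (A A2 : 'M[R]_(p, q)) :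
  dermx f v (A + A2) = dermx f v A + dermx f v A2.
Proof. by apply/matrixP => i j; rewrite !mxE poly_diffD. Qed.

Lemma dermxM p q r f v (A : 'M[R]_(p, q)) (A2 : 'M[R]_(q, r)) :
  dermx f v (A *m A2) = evmx f A *m dermx f v A2 + dermx f v A *m evmx f A2.
Proof.
apply/matrixP => i j; rewrite !mxE poly_diff_sum -big_split.
apply: eq_bigr => k _ /=; rewrite poly_diffM !mxE; congr (_ + _).
exact: mulrC.
Qed.

Lemma dermxZ p q f v h (A : 'M[R]_(p, q)) :
  dermx f v (h *: A) = poly_eval h f *: dermx f v A + poly_diff h f v *: evmx f A.
Proof.
apply/matrixP => i j; rewrite !mxE poly_diffM; congr (_ + _); exact: mulrC.
Qed.

Definition generic_mx : 'M[R]_(a, b) := \matrix_(p, q) entry m (fun i => 'X_i) p q.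

Lemma evmx_generic f : evmx f generic_mx = m f.
Proof. by apply/matrixP => p q; rewrite !mxE -entryX_eval. Qed.

Lemma dermx_generic f v : dermx f v generic_mx = m v.
Proof.
apply/matrixP => p q; rewrite !mxE /entry poly_diff_sum.
rewrite -{2}[v]vec_crd /vec linear_sum summxE; apply: eq_bigr => i _.
rewrite -mul_mpolyC poly_diffM poly_diffC mulr0 addr0 /poly_eval mevalC.
by rewrite poly_diffX linearZ mxE mulrC.
Qed.

Local Notation gmx := (graph_mx B C m).
Local Notation gmx' := (graph_mx B' C' m').

(** [aR] and [bR] are the two blocks of the generic graph in the second frame. The transition map is
    [aR^-1 * bR], that is [gR / sR] by Cramer's rule. *)
Definition aR := (cstmx B + generic_mx *m cstmx C) *m cstmx Qa'.
Definition bR := (cstmx B + generic_mx *m cstmx C) *m cstmx Qb'.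
Definition sR := \det aR.
Definition gR := \adj aR *m bR.

Lemma evmx_graph f : evmx f (cstmx B + generic_mx *m cstmx C) = gmx f.
Proof. by rewrite /evmx map_mxD map_mxM /= -!/(evmx _ _) !evmx_cst evmx_generic. Qed.

Lemma evmx_aR f : evmx f aR = gmx f *m Qa'.
Proof. by rewrite /evmx map_mxM /= -!/(evmx _ _) evmx_graph evmx_cst. Qed.

Lemma evmx_bR f : evmx f bR = gmx f *m Qb'.
Proof. by rewrite /evmx map_mxM /= -!/(evmx _ _) evmx_graph evmx_cst. Qed.

Lemma dermx_graph f v :
  dermx f v (cstmx B + generic_mx *m cstmx C) = m v *m C.
Proof.
by rewrite dermxD dermxM !dermx_cst dermx_generic evmx_cst mulmx0 !add0r.
Qed.

Lemma eval_sR f : poly_eval sR f = \det (gmx f *m Qa').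
Proof. by rewrite -evmx_aR /evmx det_map_mx. Qed.

(** The rows of [gmx f] span the graph; it lies in the second chart when their first block there is
    invertible, and normalising that block to the identity gives [gmx' f']. *)
Lemma graph_eq f (f' : E') : graph f = graph f' <->
  gmx f *m Qa' \in unitmx /\
  gmx f *m Qa' *m m' f' = gmx f *m Qb'.
Proof.
set W := gmx f; set W' := gmx' f'.
have W'Qa : W' *m Qa' = 1%:M := graph_mxQa fr' f'.
have W'Qb : W' *m Qb' = m' f' := graph_mxQb fr' f'.
have WQa : W *m Qa = 1%:M := graph_mxQa fr f.
split=> [ff'|[aU ab]].
  have [G WG] : exists G, W = G *m W'.
    have /choice [G GP] : forall i, exists r : 'rV_a, row i W = r *m W'.
      move=> i; apply/(frame_graph fr'); rewrite -ff'.
      by apply/(frame_graph fr); exists (delta_mx 0 i); rewrite rowE.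
    exists (\matrix_i G i); apply/row_matrixP => i.
    by rewrite row_mul rowK.
  have [G' WG'] : exists G', W' = G' *m W.
    have /choice [G' GP] : forall i, exists r : 'rV_a, row i W' = r *m W.
      move=> i; apply/(frame_graph fr); rewrite ff'.
      by apply/(frame_graph fr'); exists (delta_mx 0 i); rewrite rowE.
    exists (\matrix_i G' i); apply/row_matrixP => i.
    by rewrite row_mul rowK.
  have GW : G *m G' *m W = W by rewrite -mulmxA -WG' -WG.
  have GG' : G *m G' = 1%:M by rewrite -[LHS]mulmx1 -{1}WQa mulmxA GW WQa.
  have [Gu _] := mulmx1_unit GG'.
  have -> : W *m Qa' = G by rewrite WG -mulmxA W'Qa mulmx1.
  by split=> //; rewrite WG -mulmxA W'Qb.
have WW' : W = W *m Qa' *m W'.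
  by rewrite mulmxDr mulmxA ab -{1}[W]mulmx1 -(frame_sum fr') mulmxDr !mulmxA.
have W'W : invmx (W *m Qa') *m W = W'.
  by rewrite {2}WW' mulmxA mulVmx // mul1mx.
apply/vspaceP => u; apply/idP/idP.
  move/(frame_graph fr) => [r ->]; apply/(frame_graph fr').
  exists (r *m (W *m Qa')); rewrite -/(gmx f) -/(gmx' f') -/W -/W'.
  by rewrite {1}WW' !mulmxA.
move/(frame_graph fr') => [r ->]; apply/(frame_graph fr).
exists (r *m invmx (W *m Qa')); rewrite -/(gmx f) -/(gmx' f') -/W -/W'.
by rewrite -mulmxA W'W.
Qed.

Lemma graph_exists f : gmx f *m Qa' \in unitmx ->
  exists f' : E', graph f = graph f'.
Proof.
move=> aU.
have [f' Ef'] := frame_surj fr' (invmx (gmx f *m Qa') *m (gmx f *m Qb')).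
by exists f'; apply/graph_eq; split=> //; rewrite Ef' mulKVmx.
Qed.

Lemma gR_eval f (f' : E') : graph f = graph f' ->
  evmx f gR = poly_eval sR f *: m' f'.
Proof.
move/graph_eq => [aU ab].
rewrite /evmx /gR map_mxM /= map_mx_adj -!/(evmx _ _) evmx_aR evmx_bR.
by rewrite -ab mulmxA mul_adj_mx -eval_sR mul_scalar_mx.
Qed.

Lemma sR_neq0 f : poly_eval sR f != 0 <-> gmx f *m Qa' \in unitmx.
Proof. by rewrite eval_sR unitmxE unitfE. Qed.

Lemma gR_diff f (f' : E') v (v' : E') : graph f = graph f' ->
  m' v' = invmx (gmx f *m Qa') *m m v *m (C *m (Qb' - Qa' *m m' f')) ->
  poly_eval sR f ^+ 2 *: m' v' =
  poly_eval sR f *: dermx f v gR - poly_diff sR f v *: evmx f gR.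
Proof.
move=> ff' Ev'; have [aU ab] := (graph_eq f f').1 ff'.
have gE := gR_eval ff'.
apply: (can_inj (mulKmx aU)).
(* The adjugate identity [aR * gR = sR * bR] is differentiated, which avoids differentiating an
   inverse or an adjugate. *)
have : dermx f v (aR *m gR) = dermx f v (sR *: bR).
  by rewrite /gR mulmxA mul_mx_adj mul_scalar_mx.
rewrite dermxM dermxZ evmx_aR evmx_bR gE /aR /bR !(dermxM f v (_ + _)).
rewrite !dermx_cst !mulmx0 !add0r dermx_graph !evmx_cst.
move: (gmx f *m Qa') (gmx f *m Qb') aU ab Ev' => al be aU ab Ev'.
move: (dermx f v gR) (poly_eval sR f) (poly_diff sR f v) => dg s ds H.
have {}H : al *m dg = s *: (m v *m C *m Qb') + ds *: be - m v *m C *m Qa' *m (s *: m' f').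
  by rewrite -H addrK.
have {Ev'}avE : al *m m' v' = m v *m C *m Qb' - m v *m C *m Qa' *m m' f'.
  by rewrite Ev' -mulmxA mulKVmx // !mulmxBr !mulmxA.
rewrite mulmxBr -!scalemxAr H ab avE -scalemxAr.
rewrite !(scalerBr, scalerDr) !scalerA -expr2 [ds * s]mulrC.
by rewrite addrAC -[X in _ = X - _]addrA addrAC -!addrA subrr addr0.
Qed.

Lemma transition_rational : exists gam : 'I_(\dim {:E'}) -> R,
  (forall f (f' : E'), graph f = graph f' -> rational_image sR gam f f') /\
  (forall f (f' : E') v (v' : E'), graph f = graph f' ->
   m' v' = invmx (gmx f *m Qa') *m m v *m (C *m (Qb' - Qa' *m m' f')) ->
   rational_diff sR gam f v v').
Proof.
have [kap kapP] := crd_entries (frame_inj fr').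
pose gam i : R := \sum_p \sum_q (kap i p q)%:MP * gR p q.
have gamE f i : poly_eval (gam i) f = \sum_p \sum_q kap i p q * evmx f gR p q.
  rewrite /poly_eval /gam rmorph_sum; apply: eq_bigr => p _.
  rewrite rmorph_sum; apply: eq_bigr => q _.
  by rewrite rmorphM /= mevalC [in RHS]mxE.
have gamD f v i : poly_diff (gam i) f v = \sum_p \sum_q kap i p q * dermx f v gR p q.
  rewrite /gam poly_diff_sum; apply: eq_bigr => p _.
  rewrite poly_diff_sum; apply: eq_bigr => q _.
  by rewrite poly_diffM poly_diffC mulr0 addr0 /poly_eval mevalC [in RHS]mxE.
exists gam; split=> [f f' ff'|f f' v v' ff' Ev'].
  have [/sR_neq0 s0 _] := (graph_eq f f').1 ff'; split=> // i.
  rewrite gamE kapP mulr_suml; apply: eq_bigr => p _.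
  rewrite mulr_suml; apply: eq_bigr => q _.
  by rewrite (gR_eval ff') [in RHS]mxE -mulrA [m' f' p q * _]mulrC.
move=> i; rewrite kapP gamE gamD !mulr_suml -sumrB; apply: eq_bigr => p _.
rewrite !mulr_suml -sumrB; apply: eq_bigr => q _.
have /matrixP /(_ p q) := gR_diff ff' Ev'.
move: (dermx f v gR) (evmx f gR) => dg eg; rewrite !mxE => H.
by rewrite -mulrA [_ * _ ^+ 2]mulrC H; ring.
Qed.

Section Transfer.
Variables (Y : E -> Prop) (Y' : E' -> Prop).

Lemma transition_image f : poly_eval sR f != 0 -> exists f' : E', graph f = graph f'.
Proof. by move/sR_neq0; apply: graph_exists. Qed.

(** Equations of the second chart are homogenised, then multiplied by [sR] so that they hold
    automatically off the overlap, where no condition is imposed. *)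
Lemma algebraic_transfer (S : R' -> Prop) :
  (forall f, Y f <-> forall f' : E', graph f = graph f' ->
     forall p, S p -> poly_eval p f' = 0) -> algebraic Y.
Proof.
move=> YE; have [gam [im _]] := transition_rational.
exists (fun q => exists p M H, [/\ S p, homogenized sR gam p M H & q = sR * H]).
move=> f; split=> [Yf _ [p [M [H [Sp [hom _] ->]]]]|Tf].
  rewrite poly_evalM; have [->|s0] := eqVneq (poly_eval sR f) 0.
    by rewrite mul0r.
  have [f' ff'] := transition_image s0.
  by rewrite (hom _ _ (im _ _ ff')) ((YE f).1 Yf f' ff' p Sp) !mulr0.
apply/YE => f' ff' p Sp; have [M [H hom]] := homogenize sR gam p.
have [s0 _] := im _ _ ff'.
have /eqP := Tf _ (ex_intro _ p (ex_intro _ M (ex_intro _ H (And3 Sp hom erefl)))).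
rewrite poly_evalM mulf_eq0 (negPf s0) (hom.1 _ _ (im _ _ ff')) mulf_eq0.
by rewrite expf_eq0 (negPf s0) andbF => /eqP.
Qed.

Lemma tangent_transfer f (f' : E') :
  (forall g (g' : E'), graph g = graph g' -> Y g <-> Y' g') ->
  graph f = graph f' -> Y f ->
  exists G N, [/\ G \in unitmx, N \in unitmx & forall v (v' : E'),
    m' v' = G *m m v *m N -> zariski_tangent Y f v -> zariski_tangent Y' f' v'].
Proof.
move=> YY' ff' Yf; have [gam [im dim]] := transition_rational.
have [aU ab] := (graph_eq f f').1 ff'.
exists (invmx (gmx f *m Qa')), (C *m (Qb' - Qa' *m m' f')); split.
- by rewrite unitmx_inv.
(* If [r] is killed by [N], then [r *m C] lies in the common graph; its component along [U] is zero,
   so it is zero and so is [r]. *)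
- rewrite -row_free_unit -kermx_eq0; apply/rowV0P => r /sub_kermxP.
  rewrite mulmxA mulmxBr => /subr0_eq; rewrite mulmxA => rC.
  have rCE : r *m C = r *m C *m Qa' *m B' + r *m C *m Qb' *m C'.
    by rewrite -[LHS]mulmx1 -(frame_sum fr') mulmxDr !mulmxA.
  have : r *m C \in graph f.
    rewrite ff'; apply/(frame_graph fr'); exists (r *m C *m Qa').
    by rewrite {1}rCE rC mulmxDr !mulmxA.
  case/(frame_graph fr) => g rCg.
  have g0 : g = 0.
    have := congr1 (mulmx^~ Qa) rCg.
    rewrite -!mulmxA mulmxDl -!mulmxA (frame_BQa fr) (frame_CQa fr) !mulmx0 addr0.
    by rewrite mulmx1.
  by have := congr1 (mulmx^~ Qb) rCg; rewrite g0 !mul0mx -mulmxA (frame_CQb fr) mulmx1.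
move=> v v' Ev' Tv p Yp.
have [M [H [homE homD]]] := homogenize sR gam p.
have HY : vanishing_ideal Y (sR * H).
  move=> g Yg; rewrite poly_evalM; have [->|s0] := eqVneq (poly_eval sR g) 0.
    by rewrite mul0r.
  have [g' gg'] := transition_image s0.
  by rewrite (homE _ _ (im _ _ gg')) Yp ?mulr0 //; apply/(YY' _ _ gg').
have [s0 _] := im _ _ ff'.
have pf' : poly_eval p f' = 0 by apply/Yp/(YY' _ _ ff').
have := Tv _ HY; rewrite poly_diffM (homE _ _ (im _ _ ff')) pf' mulr0 mul0r addr0.
rewrite (homD _ _ _ _ (im _ _ ff') (dim _ _ _ _ ff' Ev')) pf' mulr0 addr0.
by move/eqP; rewrite mulf_eq0 expf_eq0 (negPf s0) andbF => /eqP.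
Qed.

End Transfer.

End Transition.

(** * Closed subsets of the Grassmannian *)

Section Grassmann.
Variables (K : closedFieldType) (n l : nat).
Hypothesis K0 : char0 K.
Local Notation Gr := (Gr K n l).
Implicit Types (L : Gr) (A Z : Gr -> Prop).

Lemma chart_frame L : exists B C Qa Qb m,
  @frame K n.+1 (val L) l.+1 (n - l) B C Qa Qb m.
Proof.
apply: frame_exists; first exact/eqP/(valP L).
by rewrite dimv_compl (eqP (valP L)) dimvf /dim /= mul1n subSS.
Qed.

Lemma chart_eq L L' (f : tangentGr L) (f' : tangentGr L') :
  chart f = chart f' <-> graph f = graph f'.
Proof.
by split=> [/(congr1 val)|E]; [rewrite !SubK | apply: val_inj; rewrite !SubK].
Qed.

Lemma chart_inj L : injective (@chart K n l L).
Proof.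
move=> f g /chart_eq fg; have [B [C [Qa [Qb [m fr]]]]] := chart_frame L.
apply: (frame_inj fr).
have [_] := (graph_eq fr fr f g).1 fg.
by rewrite (graph_mxQa fr) (graph_mxQb fr) mul1mx.
Qed.

Lemma chart0 L : chart (0 : tangentGr L) = L.
Proof.
apply: val_inj; rewrite SubK; apply/eqP; rewrite eq_sym eqEdim dim_graph leqnn andbT.
apply/subvP => u uL; apply/memv_imgP; exists (vsproj (val L) u); first exact: memvf.
by rewrite graph_mapE zero_lfunE linear0 addr0 vsprojK.
Qed.

(* Every point outside the chart at [L] belongs to this set. *)
Definition zero_locus L (S : {mpoly K[\dim {:tangentGr L}]} -> Prop) : Gr -> Prop :=
  fun L' => forall f : tangentGr L, chart f = L' ->
    forall p, S p -> poly_eval p f = 0.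

Lemma closed_zero_locus L S : closedGr (@zero_locus L S).
Proof.
move=> L'; have [B [C [Qa [Qb [m fr]]]]] := chart_frame L.
have [B' [C' [Qa' [Qb' [m' fr']]]]] := chart_frame L'.
apply: (algebraic_transfer fr' fr (S := S)) => f; split=> [Zf g fg p Sp|H g fg p Sp].
  by apply: (Zf g) => //; apply/chart_eq.
by apply: (H g) => //; apply/chart_eq; rewrite fg.
Qed.

(* [Z] is covered by [A] and the complement of the chart, both closed. *)
Lemma irreducible_meets_chart L A Z : irreducible Z -> Z L -> closedGr A ->
  (forall f : tangentGr L, Z (chart f) -> A (chart f)) ->
  forall L', Z L' -> A L'.
Proof.
move=> [_ irr] ZL Ac ZA.
pose N := zero_locus (fun p : {mpoly K[\dim {:tangentGr L}]} => True).
have Nc : closedGr N by apply: closed_zero_locus.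
have [L' ZL'|//|ZN] := irr A N Ac Nc.
  have [[f fL']|nf] := pselect (exists f : tangentGr L, chart f = L').
    by left; rewrite -fL'; apply: ZA; rewrite fL'.
  by right=> f fL'; case: nf; exists f.
have /eqP := ZN L ZL 0 (chart0 L) 1 I.
by rewrite /poly_eval rmorph1 oner_eq0.
Qed.

Lemma in_chart_prime L Z : irreducible Z -> Z L -> prime_set (@in_chart K n l L Z).
Proof.
move=> [ne irr] ZL; split; first by exists 0; rewrite /in_chart chart0.
move=> p q pq.
pose loc (r : {mpoly K[\dim {:tangentGr L}]}) := zero_locus (fun r' => r' = r).
have locE r (f : tangentGr L) : loc r (chart f) -> poly_eval r f = 0.
  by move/(_ f erefl r erefl).
have [|||H|H] := irr (loc p) (loc q); try exact: closed_zero_locus.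
- move=> L' ZL'; have [[f fL']|nf] := pselect (exists f : tangentGr L, chart f = L').
    have : poly_eval (p * q) f = 0 by apply: pq; rewrite /in_chart fL'.
    rewrite poly_evalM => /eqP; rewrite mulf_eq0.
    case/orP => /eqP r0; [left|right] => g gL' _ ->;
    by rewrite (chart_inj (etrans gL' (esym fL'))).
  by left=> f fL'; case: nf; exists f.
- by left=> f Zf; apply/locE/H.
- by right=> f Zf; apply/locE/H.
Qed.

Lemma in_chart_proper L A Z : irreducible Z -> closedGr A -> Z L -> Defs.proper_sub A Z ->
  exists f : tangentGr L, in_chart Z f /\ ~ in_chart A f.
Proof.
move=> Zirr Ac ZL [AZ [L' [ZL' nAL']]]; apply: contrapT => H; apply: nAL'.
apply: (irreducible_meets_chart Zirr ZL Ac) ZL' => f Zf.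
by apply: contrapT => nAf; apply: H; exists f.
Qed.

Section Closure.
Variables (L : Gr) (Y : tangentGr L -> Prop).
Hypotheses (Ya : algebraic Y) (Yp : prime_set Y).

Definition zclosure : Gr -> Prop := fun L' => forall A, closedGr A ->
  (forall f, Y f -> A (chart f)) -> A L'.

Lemma closure_sub Z : closedGr Z -> (forall f, Y f -> Z (chart f)) ->
  forall L', zclosure L' -> Z L'.
Proof. by move=> Zc YZ L' /(_ Z Zc YZ). Qed.

Lemma closure_closed : closedGr zclosure.
Proof.
move=> L'.
exists (fun p => exists A, [/\ closedGr A, forall f, Y f -> A (chart f)
  & vanishing_ideal (@in_chart K n l L' A) p]).
move=> g; split=> [Yg p [A [Ac YA Ap]]|H A Ac YA]; first exact: (Ap _ (Yg A Ac YA)).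
by apply: (algebraic_vanishing (Ac L')) => p Ap; apply: H; exists A.
Qed.

(** The zero locus of the ideal of [Y] is closed, contains the image of [Y] and meets the chart
    exactly in it, so the closure adds nothing there. *)
Lemma in_chart_closure f : in_chart zclosure f <-> Y f.
Proof.
split=> [cf|Yf]; last by move=> A _; apply.
apply: algebraic_vanishing => // p Yp0.
have YZ g : Y g -> zero_locus (vanishing_ideal Y) (chart g).
  by move=> Yg h hg q Yq; rewrite (chart_inj hg); apply: Yq.
exact: (cf _ (@closed_zero_locus L _) YZ f erefl p Yp0).
Qed.

Lemma zclosure_irreducible : irreducible zclosure.
Proof.
have [[f0 Yf0] prY] := Yp; split.
  by exists (chart f0) => A _; apply.
move=> A B Ac Bc cov.
have [YA|nYA] := pselect (forall f, Y f -> A (chart f)).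
  by left=> L'; apply: closure_sub.
have [YB|nYB] := pselect (forall f, Y f -> B (chart f)).
  by right=> L'; apply: closure_sub.
have sep D : closedGr D -> ~ (forall f, Y f -> D (chart f)) -> exists p,
    vanishing_ideal (@in_chart K n l L D) p /\ ~ vanishing_ideal Y p.
  move=> Dc nYD; apply: contrapT => H; apply: nYD => f Yf.
  apply: (algebraic_vanishing (Dc L)) => p Dp.
  suff Yp' : vanishing_ideal Y p by apply: Yp'.
  by apply: contrapT => nYp; apply: H; exists p.
have [p [Ap nYp]] := sep A Ac nYA; have [q [Bq nYq]] := sep B Bc nYB.
suff /prY [] : vanishing_ideal Y (p * q) by [].
move=> f Yf; rewrite poly_evalM.
have [|Af|Bf] := cov (chart f); first by move=> D _; apply.
  by rewrite (Ap f Af) mul0r.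
by rewrite (Bq f Bf) mulr0.
Qed.

End Closure.

Lemma dim_at_least_le Z d d' : (d' <= d)%N -> dim_at_least Z d -> dim_at_least Z d'.
Proof.
move=> led [C [Ci Cp CZ]]; exists C; split=> [i id|i id|L CL].
- by apply: Ci; apply: leq_trans led.
- by apply: Cp; apply: leq_trans led.
apply: CZ; elim: d led Ci Cp => [|d IHd].
  by rewrite leqn0 => /eqP E _ _; rewrite -E.
rewrite leq_eqVlt => /orP [/eqP <- //|]; rewrite ltnS => led Ci Cp.
apply: (Cp d (leqnn _)).1; apply: IHd => // i id; [apply: Ci | apply: Cp];
  exact: leqW.
Qed.

Lemma chain_in_chart Z d (C : nat -> Gr -> Prop) L :
  (forall i, (i <= d)%N -> irreducible_subvariety (C i)) ->
  (forall i, (i < d)%N -> Defs.proper_sub (C i) (C i.+1)) ->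
  (forall L', C d L' -> Z L') -> C 0%N L ->
  indep_of (@in_chart K n l L (C d)) d.
Proof.
move=> Ci Cp CZ C0.
have CL i : (i <= d)%N -> C i L.
  elim: i => // i IHi id; apply: (Cp i id).1; apply: IHi; exact: ltnW.
apply: (chain_indep K0 (C := fun i => @in_chart K n l L (C i))) => i id.
  by have [Cc Cirr] := Ci i id; split; [apply: Cc | apply: in_chart_prime => //; apply: CL].
split; first by move=> f; apply: (Cp i id).1.
have [Cc _] := Ci i (ltnW id); have [_ Cirr] := Ci i.+1 id.
exact: (in_chart_proper Cirr Cc (CL _ id) (Cp i id)).
Qed.

Lemma dim_of_chain Z L t : closedGr Z -> dim_of (@in_chart K n l L Z) t ->
  prime_set (@in_chart K n l L Z) -> dim_at_least Z t.
Proof.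
move=> Zc dZ pZ.
have [C [Cap Cs Ct]] := chain_below_indep K0 (Zc L) pZ (dim_of_indep dZ).
exists (fun i => zclosure (C i)); split=> [i it|i it|L'].
- by have [Ca Cp] := Cap i it; split; [apply: closure_closed | apply: zclosure_irreducible].
- have [sub [f [Cf nCf]]] := Cs i it; split.
    move=> L'; apply: closure_sub; first exact: closure_closed.
    by move=> g /sub Cg A _; apply.
  have [Ca _] := Cap i (ltnW it); have [Ca' _] := Cap i.+1 it.
  exists (chart f); split; first by move=> A _; apply.
  by move/(in_chart_closure Ca).
- by apply: closure_sub => // f; rewrite Ct.
Qed.

Lemma dim_tangentGr L : \dim {:tangentGr L} = (l.+1 * (n - l))%N.
Proof.
have [B [C [Qa [Qb [m fr]]]]] := chart_frame L.
pose f := linfun m; have kf : lker f == 0%VS.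
  by apply/lker0P => u v; rewrite !lfunE => /(frame_inj fr).
have /limg_dim_eq <- : (fullv :&: lker f = 0)%VS by rewrite (eqP kf) capv0.
have -> : limg f = fullv.
  apply/eqP; rewrite eqEsubv subvf; apply/subvP => M _.
  have [g <-] := frame_surj fr M; apply/memv_imgP; exists g; first exact: memvf.
  by rewrite lfunE.
by rewrite dimvf.
Qed.

(* The chart is centred at a point of the smallest member of a longest chain, so
   that the whole chain is visible in it. *)
Lemma exists_dim Z d : irreducible_subvariety Z -> dim_at_least Z d ->
  exists L t, [/\ Z L, dim_of (@in_chart K n l L Z) t, has_dim Z t & (d <= t)%N].
Proof.
move=> [Zc Zirr] dZ; pose ok e := `[< dim_at_least Z e >].
have below e : dim_at_least Z e -> exists L t,
    [/\ Z L, dim_of (@in_chart K n l L Z) t & (e <= t)%N].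
  move=> [C [Ci Cp CZ]]; have [_ [[L C0L] _]] := Ci 0%N isT.
  have Ce := chain_in_chart Ci Cp CZ C0L.
  have ZL : Z L.
    apply: (CZ); elim: e {CZ Ce} Ci Cp => // e IHe Ci Cp.
    apply: (Cp e (leqnn _)).1; apply: IHe => i ie; [apply: Ci | apply: Cp];
    exact: leqW.
  have [t dt] := prime_dim_of (in_chart_prime Zirr ZL).
  exists L, t; split=> //; apply: (indep_of_dim K0 _ Ce dt) => f.
  exact: CZ.
have okd : exists e, ok e by exists d; apply/asboolP.
(* The dimension of a chart bounds the length of every chain, so a longest one exists. *)
have okM e : ok e -> (e <= l.+1 * (n - l))%N.
  case/asboolP/below => L [t [_ dt]] /leq_trans; apply.
  by rewrite -(dim_tangentGr L); apply: dim_of_le dt.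
case: (ex_maxnP okd okM) => e /asboolP de maxe.
have [L [t [ZL dt et]]] := below e de.
have dZt := dim_of_chain Zc dt (in_chart_prime Zirr ZL).
exists L, t; split=> //; last by apply: leq_trans et; apply/maxe/asboolP.
split=> // dZt1; have : ok t.+1 by apply/asboolP.
by move/maxe => /leq_trans /(_ et); rewrite ltnn.
Qed.

End Grassmann.

(** * Strongly isotropic subvarieties *)

Lemma subspace_equations (K : fieldType) n (P : {vspace 'rV[K]_n}) :
  exists Z : 'M[K]_n, forall w : 'rV_n, w \in P <-> w *m Z = 0.
Proof.
pose pr (w : 'rV[K]_n) := w - projv P w.
have prL : linear pr by move=> k u v; rewrite /pr linearP scalerBr opprD addrACA.
pose prm := GRing.isLinear.Build _ _ _ _ pr prL.
pose prl : {linear 'rV[K]_n -> 'rV[K]_n} := HB.pack pr prm.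
exists (lin1_mx prl) => w; rewrite mul_rV_lin1 /= /pr; split=> [/projv_id ->|].
  by rewrite subrr.
by move/subr0_eq => ->; apply: memv_proj.
Qed.

Lemma rank1_of_rows (K : fieldType) a b (M : 'M[K]_(a, b)) (S : {vspace 'rV[K]_b}) :
  (\dim S <= 1)%N -> (forall r : 'rV_a, r *m M \in S) ->
  exists (w : 'cV_a) (r : 'rV_b), M = w *m r.
Proof.
move=> dS MS; have [z zP] := dim_le1_line dS.
have /choice [k kP] : forall i, exists k, row i M = k *: z.
  by move=> i; apply/vlineP/(subvP zP); rewrite rowE.
exists (\col_i k i), z; apply/row_matrixP => i.
by rewrite row_mul kP [row i (\col_i0 _)]mx11_scalar mul_scalar_mx !mxE.
Qed.

(** * Incidence with a fixed subspace, in a chart *)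

Section Equations.
Variables (K : closedFieldType) (n a b : nat) (U : {vspace 'rV[K]_n}).
Variables (B : 'M[K]_(a, n)) (C : 'M[K]_(b, n)) (Qa : 'M[K]_(n, a))
  (Qb : 'M[K]_(n, b)) (m : {linear hom_quot U -> 'M[K]_(a, b)}).
Hypothesis fr : frame B C Qa Qb m.
Variable P : {vspace 'rV[K]_n}.
Local Notation E := (hom_quot U).
Local Notation R := {mpoly K[\dim {:E}]}.

Lemma graph_sub_equations : exists S : R -> Prop,
  (forall f : E, (graph f <= P)%VS <-> forall q, S q -> poly_eval q f = 0) /\
  (forall f v : E, (forall q, S q -> poly_diff q f v = 0) ->
     forall r, r *m m v *m C \in P).
Proof.
have [Z ZP] := subspace_equations P.
pose M : 'M[R]_(a, n) := (cstmx U B + generic_mx m *m cstmx U C) *m cstmx U Z.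
have evM f : evmx f M = graph_mx B C m f *m Z.
  by rewrite /evmx map_mxM /= -!/(evmx _ _) evmx_graph evmx_cst.
have diffM f v : dermx f v M = m v *m C *m Z.
  by rewrite dermxM dermx_cst mulmx0 add0r dermx_graph evmx_cst.
exists (fun q => exists i j, q = M i j); split=> [f|f v H r]; last first.
  apply/ZP; have -> : r *m m v *m C *m Z = r *m dermx f v M by rewrite diffM !mulmxA.
  suff -> : dermx f v M = 0 by rewrite mulmx0.
  by apply/matrixP => i j; rewrite [LHS]mxE [RHS]mxE; apply: H; exists i, j.
split=> [fP _ [i [j ->]]|H].
  have -> : poly_eval (M i j) f = evmx f M i j by rewrite [RHS]mxE.
  rewrite evM; suff -> : graph_mx B C m f *m Z = 0 by rewrite mxE.
  apply/row_matrixP => k; rewrite row_mul row0; apply/ZP/(subvP fP)/(frame_graph fr).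
  by exists (delta_mx 0 k); rewrite rowE.
apply/subvP => _ /(frame_graph fr) [r ->]; apply/ZP.
rewrite -mulmxA -/(graph_mx B C m f) -evM.
suff -> : evmx f M = 0 by rewrite mulmx0.
by apply/matrixP => i j; rewrite [LHS]mxE [RHS]mxE; apply: H; exists i, j.
Qed.

Lemma graph_sup_equations : exists S : R -> Prop,
  (forall f : E, (P <= graph f)%VS <-> forall q, S q -> poly_eval q f = 0) /\
  (forall f v : E, (forall q, S q -> poly_diff q f v = 0) ->
     forall w, w \in P -> w *m Qa *m m v = 0).
Proof.
pose M w : 'M[R]_(1, b) := cstmx U (w *m Qb) + cstmx U (- (w *m Qa)) *m generic_mx m.
have evM w f : evmx f (M w) = w *m Qb - w *m Qa *m m f.
  by rewrite /evmx map_mxD map_mxM /= -!/(evmx _ _) !evmx_cst evmx_generic mulNmx.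
have diffM w f v : dermx f v (M w) = - (w *m Qa *m m v).
  by rewrite dermxD dermxM !dermx_cst mul0mx addr0 add0r evmx_cst dermx_generic mulNmx.
have graphP w f : w \in graph f <-> evmx f (M w) = 0.
  rewrite evM; split=> [/(memv_graph fr) ->|/subr0_eq]; first by rewrite subrr.
  by move/(memv_graph fr).
exists (fun q => exists w j, w \in P /\ q = M w 0 j); split=> [f|f v H w wP]; last first.
  apply/eqP; rewrite -oppr_eq0 -(diffM w f v); apply/eqP/matrixP => i j.
  by rewrite ord1 [LHS]mxE [RHS]mxE; apply: H; exists w, j.
split=> [Pf _ [w [j [wP ->]]]|H].
  have -> : poly_eval (M w 0 j) f = evmx f (M w) 0 j by rewrite [RHS]mxE.
  by rewrite ((graphP w f).1 (subvP Pf w wP)) mxE.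
apply/subvP => w wP; apply/graphP/matrixP => i j.
by rewrite ord1 [LHS]mxE [RHS]mxE; apply: H; exists w, j.
Qed.

Lemma frame_base u : u \in graph (0 : E) <-> exists r : 'rV_a, u = r *m B.
Proof.
split=> [/(frame_graph fr)|[r ->]]; first by rewrite linear0 mul0mx addr0.
by apply/(frame_graph fr); exists r; rewrite linear0 mul0mx addr0.
Qed.

End Equations.

Section Grassmann.
Variables (K : closedFieldType) (n l : nat).
Hypothesis K0 : char0 K.
Local Notation Gr := (Gr K n l).
Implicit Types (L : Gr) (Z : Gr -> Prop) (P : {vspace 'rV[K]_n.+1}).

Lemma closedGr_sub P : closedGr (fun L : Gr => (val L <= P)%VS).
Proof.
move=> L; have [B [C [Qa [Qb [m fr]]]]] := chart_frame L.
have [S [SP _]] := graph_sub_equations fr P.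
by exists S => f; rewrite /in_chart SubK.
Qed.

Lemma closedGr_sup P : closedGr (fun L : Gr => (P <= val L)%VS).
Proof.
move=> L; have [B [C [Qa [Qb [m fr]]]]] := chart_frame L.
have [S [SP _]] := graph_sup_equations fr P.
by exists S => f; rewrite /in_chart SubK.
Qed.

Lemma mulmxr_inj_lker p q (M : 'M[K]_(p, q)) (M' : 'M[K]_(q, p)) :
  M *m M' = 1%:M -> lker (linfun (mulmxr M : 'rV_p -> 'rV_q)) == 0%VS.
Proof.
move=> MM'; apply/lker0P => r s; rewrite !lfunE /= => /(congr1 (mulmx^~ M')).
by rewrite -!mulmxA MM' !mulmx1.
Qed.

(** Differentiating the incidence equations puts the rows of [m f *m C] in [P]. They span a space
    meeting the cone of [L] trivially, and that cone has codimension one in [P]. *)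
Lemma tangent_rank1_sub Z P L (f : tangentGr L) : \dim P = l.+2 ->
  (forall L', Z L' -> (val L' <= P)%VS) -> Z L -> tangent Z f -> (hom_rank f <= 1)%N.
Proof.
move=> dP ZP ZL Tf; have [B [C [Qa [Qb [m fr]]]]] := chart_frame L.
have [S [SP SD]] := graph_sub_equations fr P.
have rowsP : forall r, r *m m f *m C \in P.
  apply: (SD 0) => q Sq; apply: Tf => g Zg.
  by apply: (SP g).1 => //; have := ZP _ Zg; rewrite SubK.
apply/(frame_rank fr).
pose j := linfun (mulmxr C : 'rV_(n - l) -> 'rV_n.+1).
have kj : lker j == 0%VS := mulmxr_inj_lker (frame_CQb fr).
apply: (rank1_of_rows (S := (j @^-1: P)%VS)) => [|r]; last first.
  by rewrite -memv_preim lfunE; apply: rowsP.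
have <- : \dim (j @: (j @^-1: P)) = \dim (j @^-1: P).
  by apply: limg_dim_eq; rewrite (eqP kj) capv0.
set S' := (j @: _)%VS; have S'P : (S' <= P)%VS.
  by apply/subvP => _ /memv_imgP [r rP ->]; rewrite memv_preim.
have LS' : (val L :&: S' = 0)%VS.
  apply/eqP; rewrite -subv0; apply/subvP => u; rewrite memv_cap memv0.
  case/andP => uL /memv_imgP [r _]; rewrite lfunE /= => ur.
  move: uL; rewrite -{1}(chart0 L) SubK => /(frame_base fr) [r' ur'].
  have : u *m Qa = 0 by rewrite ur -mulmxA (frame_CQa fr) mulmx0.
  by rewrite ur' -mulmxA (frame_BQa fr) mulmx1 => ->; rewrite mul0mx.
have : (val L + S' <= P)%VS by rewrite subv_add (ZP _ ZL).
move/dimvS; rewrite (dimv_disjoint_sum LS') dP (eqP (valP L)).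
by rewrite -addn2 -[l.+1]addn1 -addnA leq_add2l add1n ltnS.
Qed.

(** Dually, [m f] kills the image of [P], a hyperplane of its source. *)
Lemma tangent_rank1_sup Z P L (f : tangentGr L) : \dim P = l ->
  (forall L', Z L' -> (P <= val L')%VS) -> Z L -> tangent Z f -> (hom_rank f <= 1)%N.
Proof.
move=> dP ZP ZL Tf; have [B [C [Qa [Qb [m fr]]]]] := chart_frame L.
have [S [SP SD]] := graph_sup_equations fr P.
have kerP : forall w, w \in P -> w *m Qa *m m f = 0.
  apply: (SD 0) => q Sq; apply: Tf => g Zg.
  by apply: (SP g).1 => //; have := ZP _ Zg; rewrite SubK.
apply/(frame_rank fr).
pose g := linfun (mulmxr (m f) : 'rV_l.+1 -> 'rV_(n - l)).
apply: (rank1_of_rows (S := limg g)) => [|r]; last first.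
  by apply/memv_imgP; exists r; rewrite ?memvf // lfunE.
pose j := linfun (mulmxr Qa : 'rV_n.+1 -> 'rV_l.+1).
have dj : \dim (j @: P) = l.
  rewrite -[RHS]dP; apply: limg_dim_eq; apply/eqP; rewrite -subv0; apply/subvP => w.
  rewrite memv_cap memv_ker memv0 lfunE /= => /andP [wP /eqP wQ].
  have /(subvP (ZP _ ZL)) := wP.
  rewrite -{1}(chart0 L) SubK => /(frame_base fr) [r wr].
  by move: wQ; rewrite wr -mulmxA (frame_BQa fr) mulmx1 => ->; rewrite mul0mx.
have sub : (j @: P <= lker g)%VS.
  apply/subvP => _ /memv_imgP [w wP ->].
  by rewrite memv_ker !lfunE /= kerP.
have := limg_ker_dim g fullv; rewrite capfv dimvf /dim /= mul1n => E.
rewrite -(leq_add2l l) addn1; apply: leq_trans (eq_leq E).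
by rewrite leq_add2r -[leqLHS]dj; apply: dimvS.
Qed.

Lemma dim_tangent_transfer L L' (T : {vspace tangentGr L}) (T' : {vspace tangentGr L'})
    (a b : nat) (m : {linear tangentGr L -> 'M[K]_(a, b)})
    (m' : {linear tangentGr L' -> 'M[K]_(a, b)}) G N :
  injective m -> injective m' -> (forall M, exists f, m' f = M) ->
  G \in unitmx -> N \in unitmx ->
  (forall v v', m' v' = G *m m v *m N -> v \in T -> v' \in T') ->
  (\dim T <= \dim T')%N.
Proof.
move=> injm injm' surj GU NU TT'.
have /choice [phi phiP] : forall v, exists v', m' v' = G *m m v *m N.
  by move=> v; apply: surj.
have phiL : linear phi.
  move=> k u v; apply: injm'; rewrite linearP !phiP linearP mulmxDr mulmxDl.
  by rewrite -scalemxAr -scalemxAl.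
pose phim := GRing.isLinear.Build _ _ _ _ phi phiL.
pose phil : {linear tangentGr L -> tangentGr L'} := HB.pack phi phim.
have kphi : (T :&: lker (linfun phil) = 0)%VS.
  apply/eqP; rewrite -subv0; apply/subvP => v; rewrite memv_cap memv_ker memv0.
  rewrite lfunE /= => /andP [_ /eqP pv].
  have := phiP v; rewrite pv linear0 => /esym /(congr1 (mulmx^~ (invmx N))).
  rewrite mulmxK // mul0mx => /(congr1 (mulmx (invmx G))).
  by rewrite mulKmx // mulmx0 -(linear0 m) => /injm ->.
rewrite -(limg_dim_eq kphi); apply: dimvS; apply/subvP => _ /memv_imgP [v vT ->].
by rewrite lfunE; apply: TT' vT; apply: phiP.
Qed.

(** Smoothness at [chart xi] concerns the chart centred there. Transfer in both directions shows
    that the tangent space keeps dimension [t], so the point is smooth; the factorisation of rank at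
    most one then returns through the inverses of [G] and [N]. *)
Lemma generic_rank1 Z L t (B : 'M[K]_(l.+1, n.+1)) (C : 'M[K]_(n - l, n.+1)) Qa Qb
    (m : {linear tangentGr L -> 'M[K]_(l.+1, n - l)}) (fr : frame B C Qa Qb m)
    (xi : tangentGr L) (T : {vspace tangentGr L}) :
  strongly_isotropic Z -> has_dim Z t -> in_chart Z xi ->
  (forall v, v \in T <-> zariski_tangent (@in_chart K n l L Z) xi v) -> \dim T = t ->
  forall v, v \in T -> forall p q p' q', m v p q * m v p' q' = m v p q' * m v p' q.
Proof.
move=> [_ _ iso] dZ Zxi TP dT.
pose L' := chart xi; have [B' [C' [Qa' [Qb' [m' fr']]]]] := chart_frame L'.
have E : graph xi = graph (0 : tangentGr L') by apply/chart_eq; rewrite chart0.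
have compat (L1 L2 : Gr) (g : tangentGr L1) (g' : tangentGr L2) :
    graph g = graph g' -> in_chart Z g <-> in_chart Z g'.
  by move/chart_eq; rewrite /in_chart => ->.
have [G [N [GU NU GN]]] := tangent_transfer fr fr' (@compat L L') E Zxi.
have Z0 : in_chart Z (0 : tangentGr L') by rewrite /in_chart chart0.
have [G' [N' [GU' NU' GN']]] := tangent_transfer fr' fr (@compat L' L) (esym E) Z0.
have [T' TP'] := vspace_of_closed (zariski_tangent0 (Y := @in_chart K n l L' Z) 0)
  (@zariski_tangentL _ _ (@in_chart K n l L' Z) 0).
have dT' : \dim T' = t.
  apply/eqP; rewrite eqn_leq -dT; apply/andP; split.
    apply: (dim_tangent_transfer (frame_inj fr') (frame_inj fr) (frame_surj fr) GU' NU').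
    by move=> v v' H /TP' vT; apply/TP/(GN' v).
  apply: (dim_tangent_transfer (frame_inj fr) (frame_inj fr') (frame_surj fr') GU NU).
  by move=> v v' H /TP vT; apply/TP'/(GN v).
have sm : smooth_point Z L'.
  by split; [exact: Zxi | exists T'; split; rewrite ?dT'].
move=> v /TP vT; have [v' v'E] := frame_surj fr' (G *m m v *m N).
have := iso L' sm v' (GN v v' v'E vT); move/(frame_rank fr') => [w [r mv']].
have mv : m v = (invmx G *m w) *m (r *m invmx N).
  by rewrite mulmxA -[invmx G *m w *m r]mulmxA -mv' v'E -!mulmxA mulmxV // mulmx1 mulKmx.
move=> p q p' q'; rewrite mv.
rewrite [(_ *m (r *m _)) p q]mxE [(_ *m (r *m _)) p' q']mxE.
rewrite [(_ *m (r *m _)) p q']mxE [(_ *m (r *m _)) p' q]mxE !big_ord1; ring.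
Qed.

(** When the column [u] is common, any row [r] orthogonal to it satisfies [r *m m xi = 0], so
    [r *m B] stays in every graph; such rows form a hyperplane. *)
Lemma pencil_sup L (B : 'M[K]_(l.+1, n.+1)) (C : 'M[K]_(n - l, n.+1)) Qa Qb
    (m : {linear tangentGr L -> 'M[K]_(l.+1, n - l)}) (fr : frame B C Qa Qb m)
    p0 (u : 'I_l.+1 -> K) : u p0 = 1 ->
  exists P, \dim P = l /\ forall xi : tangentGr L,
    (forall p q, m xi p q = u p * m xi p0 q) -> (P <= graph xi)%VS.
Proof.
move=> u1; pose U : 'cV[K]_l.+1 := \col_i u i.
pose g := linfun (mulmxr U : 'rV_l.+1 -> 'rV_1).
pose j := linfun (mulmxr B : 'rV_l.+1 -> 'rV_n.+1).
exists (j @: lker g)%VS; split.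
  have -> : \dim (j @: lker g) = \dim (lker g).
    by apply: limg_dim_eq; rewrite (eqP (mulmxr_inj_lker (frame_BQa fr))) capv0.
  have := limg_ker_dim g fullv; rewrite capfv dimvf /dim /= mul1n.
  have -> : limg g = fullv.
    apply/eqP; rewrite eqEsubv subvf; apply/subvP => w _.
    apply/memv_imgP; exists (w 0 0 *: delta_mx 0 p0); first exact: memvf.
    rewrite lfunE /= -scalemxAl -rowE; apply/rowP => i.
    by rewrite ord1 !mxE u1 mulr1.
  by rewrite dimvf /dim /= mul1n addn1 => [[]].
move=> xi xiP; apply/subvP => _ /memv_imgP [r rU ->]; apply/(frame_graph fr).
exists r; rewrite lfunE /= mulmxDr mulmxA.
suff -> : r *m m xi = 0 by rewrite mul0mx addr0.
move: rU; rewrite memv_ker lfunE /= => /eqP /matrixP /(_ 0 0); rewrite !mxE => rU.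
apply/rowP => q; rewrite !mxE.
under eq_bigr => p _ do rewrite xiP mulrA.
rewrite -mulr_suml [X in X * _](_ : _ = 0) ?mul0r // -[RHS]rU.
by apply: eq_bigr => p _; rewrite mxE.
Qed.

(** When the row [u] is common, every graph deviates from [L] only along the single vector [U *m C],
    so [P] is the cone of [L] extended by that vector. *)
Lemma pencil_sub L (B : 'M[K]_(l.+1, n.+1)) (C : 'M[K]_(n - l, n.+1)) Qa Qb
    (m : {linear tangentGr L -> 'M[K]_(l.+1, n - l)}) (fr : frame B C Qa Qb m)
    q0 (u : 'I_(n - l) -> K) : u q0 = 1 ->
  exists P, \dim P = l.+2 /\ forall xi : tangentGr L,
    (forall p q, m xi p q = u q * m xi p q0) -> (graph xi <= P)%VS.
Proof.
move=> u1; pose U : 'rV[K]_(n - l) := \row_i u i.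
exists (val L + <[U *m C]>)%VS; split.
  rewrite dimv_disjoint_sum ?(eqP (valP L)) ?dim_vline.
    suff -> : U *m C != 0 by rewrite addn1.
    apply/negP => /eqP UC0.
    have := congr1 (mulmx^~ Qb) UC0; rewrite -mulmxA (frame_CQb fr) mul0mx mulmx1.
    by move/rowP/(_ q0); rewrite !mxE u1 => /eqP; rewrite oner_eq0.
  apply/eqP; rewrite -subv0; apply/subvP => w; rewrite memv_cap memv0.
  case/andP => wL /vlineP [k wk]; move: wL.
  rewrite -{1}(chart0 L) SubK => /(frame_base fr) [r wr].
  have := congr1 (mulmx^~ Qa) wr.
  rewrite {1}wk -mulmxA (frame_BQa fr) mulmx1 -scalemxAl -mulmxA (frame_CQa fr).
  by rewrite mulmx0 scaler0 => r0; rewrite wr -r0 mul0mx.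
move=> xi xiP; apply/subvP => _ /(frame_graph fr) [r ->].
rewrite mulmxDr mulmxA; apply: memv_add.
  by rewrite -(chart0 L) SubK; apply/(frame_base fr); exists r.
apply/vlineP; exists ((r *m col q0 (m xi)) 0 0).
rewrite scalemxAl; congr (_ *m _); apply/rowP => q; rewrite !mxE mulr_suml.
by apply: eq_bigr => p _; rewrite xiP mxE mulrA mulrAC.
Qed.

Lemma strongly_isotropic_pencil Z : irreducible_subvariety Z -> dim_at_least Z 2 ->
  strongly_isotropic Z ->
  (exists P, \dim P = l.+2 /\ forall L, Z L -> (val L <= P)%VS) \/
  (exists P, \dim P = l /\ forall L, Z L -> (P <= val L)%VS).
Proof.
move=> Zi dZ iso; have [Zc Zirr] := Zi.
have [L [t [ZL [F [c [x [h [px gx bx]]]]] hdt t2]]] := exists_dim K0 Zi dZ.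
have [B [C [Qa [Qb [m fr]]]]] := chart_frame L.
have r1 := rank1_ders_of_tangents (m := m) px gx.
have [s [s0 sP]] := generic_tangent_dim K0 px gx bx.
have rk : rank1_ders c (fun p q => mmap c x (entry m (fun i => 'X_i) p q)).
  apply: r1; exists s; split=> // xi Zxi sxi v Tv.
  have [T [TP dT]] := sP xi Zxi sxi.
  by apply: (generic_rank1 fr iso hdt Zxi TP dT); apply/TP.
have Z0 : @in_chart K n l L Z 0 by rewrite /in_chart chart0.
have [[p0 [u [u1 uP]]]|[q0 [u [u1 uP]]]] :=
  isotropic_pencil K0 px gx (frame_inj fr) bx t2 Z0 rk.
  right; have [P [dP PP]] := pencil_sup fr u1; exists P; split=> // L'.
  apply: (irreducible_meets_chart Zirr ZL (closedGr_sup P)) => xi Zxi.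
  by rewrite SubK; apply: PP; apply: uP.
left; have [P [dP PP]] := pencil_sub fr u1; exists P; split=> // L'.
apply: (irreducible_meets_chart Zirr ZL (closedGr_sub P)) => xi Zxi.
by rewrite SubK; apply: PP; apply: uP.
Qed.


End Grassmann.

Theorem theorem11 (K : closedFieldType) (charK0 : [pchar K]%R =i pred0)
    (n l : nat) (hl : (l < n)%N) (Sigma : Gr K n l -> Prop)
    (irrSigma : irreducible_subvariety Sigma)
    (dimSigma : dim_at_least Sigma 2) :
  strongly_isotropic Sigma <->
  ((exists P : {vspace 'rV[K]_n.+1},
      \dim P = l.+2 /\ forall L : Gr K n l, Sigma L -> (val L <= P)%VS) \/
   (exists P : {vspace 'rV[K]_n.+1},
      \dim P = l /\ forall L : Gr K n l, Sigma L -> (P <= val L)%VS)).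
Proof.
have K0 : char0 K by move=> d; rewrite ((pcharf0P K).1 charK0).
split; first exact: strongly_isotropic_pencil.
move=> H; split=> // [|L [ZL _] f Tf]; first exact: dim_at_least_le dimSigma.
case: H => [] [P [dP ZP]].
  exact: tangent_rank1_sub dP ZP ZL Tf.
exact: tangent_rank1_sup dP ZP ZL Tf.
Qed.
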